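(* Let $\vec X=(X_0,X_1)$ and $\vec Y=(Y_0,Y_1)$ be couples of regular Banach lattices with the Fatou property and let $T:X_0+X_1\to Y_0+Y_1$ be a positive operator which is bounded $X_j\to Y_j$, $j=0,1$. If $T:X_0^{1-\theta_*}X_1^{\theta_*}\to Y_0^{1-\theta_*}Y_1^{\theta_*}$ is an order isomorphism for some $\theta_*\in(0,1)$, then $$T:X_0^{1-\theta}X_1^\theta\to Y_0^{1-\theta}Y_1^\theta\quad\text{and}\quad T:(X_0,X_1)_{\theta,p}\to(Y_0,Y_1)_{\theta,p}$$ are order isomorphisms for all $\theta\in(0,1)$ and all $p\in[1,\infty]$.
   Context: A Banach lattice on a $\sigma$-finite measure space $(\Omega,\Sigma,\mu)$ is a Banach space $X\subset L^0(\mu)$ containing a $\mu$-a.e. strictly positive element and solid: if $f\in L^0(\mu)$, $g\in X$, $|f|\le|g|$ a.e., then $f\in X$ and $\|f\|_X\le\|g\|_X$. Fatou property: if $0\le f_n\uparrow f$ a.e. with $f_n\in X$ and $\sup_n\|f_n\|_X<\infty$, then $f\in X$ and $\|f_n\|_X\uparrow\|f\|_X$. A Banach lattice is regular if its norm is order continuous (absolutely continuous); for couples of regular lattices $X_0\cap X_1$ is dense in each Calderón product $X_0^{1-\alpha}X_1^\alpha$, $\alpha\in(0,1)$. The Calderón product $X_0^{1-\theta}X_1^\theta$ consists of $f\in L^0(\mu)$ with $|f|\le\lambda|f_0|^{1-\theta}|f_1|^\theta$ a.e. for some $\lambda>0$ and $\|f_j\|_{X_j}\le1$, normed by the infimum of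 such $\lambda$. $(X_0,X_1)_{\theta,p}$ is the real interpolation space with norm $\big(\int_0^\infty(t^{-\theta}K(t,x;\vec X))^p\,dt/t\big)^{1/p}$ (sup for $p=\infty$), $K(t,x;\vec X)=\inf\{\|x_0\|_{X_0}+t\|x_1\|_{X_1}:x=x_0+x_1\}$; it is again a Banach lattice. $T$ is positive if $Tf\ge0$ whenever $f\ge0$. An order isomorphism is a linear bijection $T$ with $T$ and $T^{-1}$ both positive. *)

(* Defs.v *)
From HB Require Import structures.
From mathcomp Require Import all_boot all_order all_algebra.
From mathcomp Require Import all_classical all_reals all_analysis.
Set Implicit Arguments.
Unset Strict Implicit.
Unset Printing Implicit Defensive.
Import Order.TTheory GRing.Theory Num.Theory.
Import numFieldNormedType.Exports.
Local Open Scope classical_set_scope.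
Local Open Scope ring_scope.

(* A (Banach) function lattice on (T, mu) is encoded by an extended-valued
   norm N : (T -> R) -> \bar R; the space is X = {f measurable | N f < +oo},
   and N restricted to X is the norm of X.  Elements of L^0 are handled as
   measurable functions, all identities being taken mu-a.e. *)

Section Defs.
Context {R : realType}.

Definition inX d (T : measurableType d) (N : (T -> R) -> \bar R) (f : T -> R) :=
  measurable_fun setT f /\ (N f < +oo)%E.

Definition banach_lattice d (T : measurableType d) (mu : {measure set T -> \bar R})
  (N : (T -> R) -> \bar R) : Prop :=
  (forall f : T -> R, measurable_fun setT f -> (0 <= N f)%E) /\
  (forall f : T -> R, measurable_fun setT f -> N f = 0%E <-> {ae mu, forall x, f x = 0}) /\
  (forall (a : R) (f : T -> R), measurable_fun setT f -> N (fun x => a * f x) = (`|a|%:E * N f)%E) /\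
  (forall f g : T -> R, measurable_fun setT f -> measurable_fun setT g ->
     (N (fun x => (f x + g x)%R) <= N f + N g)%E) /\
  (forall f g : T -> R, measurable_fun setT f -> measurable_fun setT g ->
     {ae mu, forall x, `|f x| <= `|g x|} -> (N f <= N g)%E) /\
  (exists w : T -> R, inX N w /\ {ae mu, forall x, 0 < w x}) /\
  (forall u : nat -> T -> R, (forall n, inX N (u n)) ->
     (forall e : R, 0 < e -> exists n0, forall n m, (n0 <= n)%N -> (n0 <= m)%N ->
        (N (fun x => (u n x - u m x)%R) < e%:E)%E) ->
     exists f : T -> R, inX N f /\ (fun n => N (fun x => u n x - f x)) @ \oo --> 0%E).

Definition fatou_property d (T : measurableType d) (mu : {measure set T -> \bar R})
  (N : (T -> R) -> \bar R) : Prop :=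
  forall (fs : nat -> T -> R) (f : T -> R),
    (forall n, inX N (fs n)) -> measurable_fun setT f ->
    {ae mu, forall x, forall n, 0 <= fs n x /\ fs n x <= fs n.+1 x} ->
    {ae mu, forall x, fs ^~ x @ \oo --> f x} ->
    (exists M : R, forall n, (N (fs n) <= M%:E)%E) ->
    inX N f /\ (fun n => N (fs n)) @ \oo --> N f.

Definition regular d (T : measurableType d) (mu : {measure set T -> \bar R})
  (N : (T -> R) -> \bar R) : Prop :=
  forall fs : nat -> T -> R,
    (forall n, inX N (fs n)) ->
    {ae mu, forall x, forall n, 0 <= fs n.+1 x /\ fs n.+1 x <= fs n x} ->
    {ae mu, forall x, fs ^~ x @ \oo --> 0} ->
    (fun n => N (fs n)) @ \oo --> 0%E.

Definition calderon d (T : measurableType d) (mu : {measure set T -> \bar R})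
  (N0 N1 : (T -> R) -> \bar R) (theta : R) (f : T -> R) : \bar R :=
  ereal_inf [set l%:E | l in [set l : R | 0 < l /\
     exists f0 f1, [/\ inX N0 f0, inX N1 f1, (N0 f0 <= 1)%E, (N1 f1 <= 1)%E &
        {ae mu, forall x, `|f x| <= l * (`|f0 x| `^ (1 - theta) * `|f1 x| `^ theta)}]]].

Definition inSum d (T : measurableType d) (mu : {measure set T -> \bar R})
  (N0 N1 : (T -> R) -> \bar R) (f : T -> R) :=
  measurable_fun setT f /\
  exists f0 f1, [/\ inX N0 f0, inX N1 f1 & {ae mu, forall x, f x = f0 x + f1 x}].

Definition Kfun d (T : measurableType d) (mu : {measure set T -> \bar R})
  (N0 N1 : (T -> R) -> \bar R) (t : R) (f : T -> R) : \bar R :=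
  ereal_inf [set (N0 p.1 + t%:E * N1 p.2)%E | p in
     [set p : (T -> R) * (T -> R) | [/\ inX N0 p.1, inX N1 p.2 &
        {ae mu, forall x, f x = p.1 x + p.2 x}]]].

Definition posR : set R := `]0, +oo[%classic.

Definition realint d (T : measurableType d) (mu : {measure set T -> \bar R})
  (N0 N1 : (T -> R) -> \bar R) (theta : R) (p : \bar R) (f : T -> R) : \bar R :=
  match p with
  | r%:E => ((\int[@lebesgue_measure R]_(t in posR)
               ((((t `^ (- theta)%R)%:E * Kfun mu N0 N1 t f) `^ r) * (t^-1)%R%:E))
             `^ (r^-1)%R)%E
  | +oo%E => ereal_sup [set ((t `^ (- theta)%R)%:E * Kfun mu N0 N1 t f)%E
                         | t in posR]
  | -oo%E => +oo%E
  end.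

Definition linear_op d1 d2 (S1 : measurableType d1) (S2 : measurableType d2)
  (mu : {measure set S1 -> \bar R}) (nu : {measure set S2 -> \bar R})
  (X0 X1 : (S1 -> R) -> \bar R) (Y0 Y1 : (S2 -> R) -> \bar R)
  (Top : (S1 -> R) -> (S2 -> R)) : Prop :=
  [/\ (forall f : S1 -> R, inSum mu X0 X1 f -> inSum nu Y0 Y1 (Top f)),
      (forall f g : S1 -> R, inSum mu X0 X1 f -> inSum mu X0 X1 g ->
         {ae mu, forall x, f x = g x} -> {ae nu, forall y, Top f y = Top g y}) &
      (forall (a b : R) f g, inSum mu X0 X1 f -> inSum mu X0 X1 g ->
         {ae nu, forall y, Top (fun x => a * f x + b * g x) y = a * Top f y + b * Top g y})].

Definition positive_op d1 d2 (S1 : measurableType d1) (S2 : measurableType d2)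
  (mu : {measure set S1 -> \bar R}) (nu : {measure set S2 -> \bar R})
  (X0 X1 : (S1 -> R) -> \bar R) (Top : (S1 -> R) -> (S2 -> R)) : Prop :=
  forall f, inSum mu X0 X1 f -> {ae mu, forall x, 0 <= f x} ->
    {ae nu, forall y, 0 <= Top f y}.

Definition bounded_op d1 d2 (S1 : measurableType d1) (S2 : measurableType d2)
  (X : (S1 -> R) -> \bar R) (Y : (S2 -> R) -> \bar R)
  (Top : (S1 -> R) -> (S2 -> R)) : Prop :=
  exists C : R, forall f, inX X f -> inX Y (Top f) /\ (Y (Top f) <= C%:E * X f)%E.

Definition order_iso d1 d2 (S1 : measurableType d1) (S2 : measurableType d2)
  (mu : {measure set S1 -> \bar R}) (nu : {measure set S2 -> \bar R})
  (Z : (S1 -> R) -> \bar R) (W : (S2 -> R) -> \bar R)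
  (Top : (S1 -> R) -> (S2 -> R)) : Prop :=
  [/\ (forall f : S1 -> R, inX Z f -> inX W (Top f)),
      (forall f g : S1 -> R, inX Z f -> inX Z g -> {ae nu, forall y, Top f y = Top g y} ->
         {ae mu, forall x, f x = g x}),
      (forall g, inX W g -> exists f, inX Z f /\ {ae nu, forall y, Top f y = g y}),
      (forall f : S1 -> R, inX Z f -> {ae mu, forall x, 0 <= f x} -> {ae nu, forall y, 0 <= Top f y}) &
      (forall f : S1 -> R, inX Z f -> {ae nu, forall y, 0 <= Top f y} -> {ae mu, forall x, 0 <= f x})].

End Defs.

(* Main.v *)
Require Import Defs.
From HB Require Import structures.
From mathcomp Require Import all_boot all_order all_algebra.
From mathcomp Require Import all_classical all_reals all_analysis measurable_realfun.
From mathcomp Require Import lra ring.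
Import Order.TTheory GRing.Theory Num.Theory.
Import numFieldNormedType.Exports.
Set Implicit Arguments.
Unset Strict Implicit.
Unset Printing Implicit Defensive.
Local Open Scope classical_set_scope.
Local Open Scope ring_scope.

(* The operator is an order isomorphism already at the endpoints X_j -> Y_j;
   everything else then follows by interpolating Top and its positive inverse.

   Order continuity of the norms extends the lattice isomorphism from the
   Calderon product at s = theta_* to X_0 + X_1: there Top is bipositive and
   its range is an order ideal. For surjectivity at the endpoint 0, let y be in
   the unit ball of Y_0. Surjectivity at s gives a constant D such that for
   every x_1 >= 0 in the unit ball of X_1 there are x_0, x_1' >= 0 in the unit
   balls with y^(1-s) (Top x_1)^s <= D (Top x_0)^(1-s) (Top x_1')^s. Iterating
   with x_1' in place of x_1 and multiplying, the factors Top x_1 telescope;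
   after an n-th root, AM-GM and the domination of the whole sequence (x_1,n)
   by 2^(n+1) v with a single v in X_1 leave y <= E Top g_n on sets increasing
   to the whole space, with g_n in the unit ball of X_0. The Fatou property
   turns this into y <= Top g with g in X_0. *)

(** The Calderon and real constructions at another theta are controlled through the endpoint spaces,
    so what is known at theta_* has to be pushed out to the endpoints before it can be interpolated
    back.

    Uniformity of D is essential: each step replaces x_1 by some x_1' of which only the norm and the
    sign are known, so a constant depending on x_1 could not be iterated. Dominating the sequence
    costs a factor exponential in n, which the n-th root reduces to a constant; this is why the
    crude bound 2^(n+1) v suffices.

    The g_n need not be monotone, so the Fatou property is not applied to them. It is applied to the
    preimages of |y| cut off to the increasing sets: these exist because the range is an ideal,
    increase because Top is bipositive, and lie below the g_n.

    The endpoint 1 is the endpoint 0 of the reversed couple, with 1 - s in place of s. Since an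
    order isomorphism is expressed by membership and sign alone, fixed numerical losses such as the
    3 in [op_geomean] do no harm. *)

Section MeasurableFunctions.
Context {R : realType} d (T : measurableType d).
Implicit Types f g : T -> R.

Lemma measurable_addf f g : measurable_fun setT f -> measurable_fun setT g ->
  measurable_fun setT (fun x => f x + g x).
Proof. exact: measurable_funD. Qed.

Lemma measurable_subf f g : measurable_fun setT f -> measurable_fun setT g ->
  measurable_fun setT (fun x => f x - g x).
Proof. exact: measurable_funB. Qed.

Lemma measurable_mulf f g : measurable_fun setT f -> measurable_fun setT g ->
  measurable_fun setT (fun x => f x * g x).
Proof. exact: measurable_funM. Qed.

Lemma measurable_scalef (a : R) f : measurable_fun setT f ->
  measurable_fun setT (fun x => a * f x).
Proof. by move=> mf; apply: measurable_mulf => //; exact: measurable_cst. Qed.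

Lemma measurable_oppf f : measurable_fun setT f -> measurable_fun setT (fun x => - f x).
Proof. exact: measurable_funN. Qed.

Lemma measurable_normf f : measurable_fun setT f ->
  measurable_fun setT (fun x => `|f x|).
Proof. by move=> mf; apply: (measurableT_comp (@normr_measurable R setT)). Qed.

Lemma measurable_minf f g : measurable_fun setT f -> measurable_fun setT g ->
  measurable_fun setT (fun x => Num.min (f x) (g x)).
Proof. exact: measurable_minr. Qed.

Lemma measurable_maxf f g : measurable_fun setT f -> measurable_fun setT g ->
  measurable_fun setT (fun x => Num.max (f x) (g x)).
Proof. exact: measurable_maxr. Qed.

Lemma measurable_powRf f p : measurable_fun setT f ->
  measurable_fun setT (fun x => f x `^ p).
Proof. exact: (measurableT_comp (measurable_powR p)). Qed.

Lemma measurable_if0 f (b : T -> bool) : measurable_fun setT f ->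
  measurable_fun setT b -> measurable_fun setT (fun x => if b x then f x else 0).
Proof.
move=> mf mb; apply: measurable_fun_ifT => //; exact: measurable_cst.
Qed.

End MeasurableFunctions.

(** * Consequences of the Banach lattice axioms *)

Section BanachLattice.
Context {R : realType} d (T : measurableType d) (mu : {measure set T -> \bar R}).
Context (N : (T -> R) -> \bar R) (bl : banach_lattice mu N).
Implicit Types f g : T -> R.

Lemma lnorm_ge0 f : measurable_fun setT f -> (0 <= N f)%E.
Proof. by case: bl => + _; exact. Qed.

Lemma lnorm_eq0 f : measurable_fun setT f -> N f = 0%E ->
  {ae mu, forall x, f x = 0}.
Proof. by case: bl => _ [h _] mf; case: (h f mf). Qed.

Lemma lnormZ a f : measurable_fun setT f ->
  N (fun x => a * f x) = (`|a|%:E * N f)%E.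
Proof. by case: bl => _ [_ [+ _]]; exact. Qed.

Lemma lnormD f g : measurable_fun setT f -> measurable_fun setT g ->
  (N (fun x => (f x + g x)%R) <= N f + N g)%E.
Proof. by case: bl => _ [_ [_ [+ _]]]; exact. Qed.

Lemma lnorm_le f g : measurable_fun setT f -> measurable_fun setT g ->
  {ae mu, forall x, `|f x| <= `|g x|} -> (N f <= N g)%E.
Proof. by case: bl => _ [_ [_ [_ [+ _]]]]; exact. Qed.

Lemma ex_weak_unit : exists w, inX N w /\ {ae mu, forall x, 0 < w x}.
Proof. by case: bl => _ [_ [_ [_ [_ [+ _]]]]]. Qed.

Lemma lnorm_complete (u : nat -> T -> R) : (forall n, inX N (u n)) ->
  (forall e : R, 0 < e -> exists n0, forall n m, (n0 <= n)%N -> (n0 <= m)%N ->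
     (N (fun x => (u n x - u m x)%R) < e%:E)%E) ->
  exists f, inX N f /\ (fun n => N (fun x => u n x - f x)) @ \oo --> 0%E.
Proof. by case: bl => _ [_ [_ [_ [_ [_ +]]]]]; exact. Qed.

Lemma inX_le f g : inX N g -> measurable_fun setT f ->
  {ae mu, forall x, `|f x| <= `|g x|} -> inX N f.
Proof.
by move=> [mg Ng] mf fg; split=> //; apply: le_lt_trans Ng; exact: lnorm_le.
Qed.

Lemma inXZ a f : inX N f -> inX N (fun x => a * f x).
Proof.
move=> [mf Nf]; split; first exact: measurable_scalef.
by rewrite lnormZ//; apply: lte_mul_pinfty => //; rewrite ?lee_fin.
Qed.

Lemma inXD f g : inX N f -> inX N g -> inX N (fun x => f x + g x).
Proof.
move=> [mf Nf] [mg Ng]; split; first exact: measurable_addf.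
by apply: le_lt_trans (lnormD mf mg) _; exact: lte_add_pinfty.
Qed.

Lemma inX_norm f : inX N f -> inX N (fun x => `|f x|).
Proof.
move=> h; apply: (inX_le h); first by apply: measurable_normf; case: h.
by apply: aeW => x; rewrite normr_id.
Qed.

Lemma lnorm_abs f : measurable_fun setT f -> N (fun x => `|f x|) = N f.
Proof.
move=> mf; apply/eqP; rewrite eq_le; apply/andP; split.
  apply: lnorm_le => //; first exact: measurable_normf.
  by apply: aeW => x; rewrite normr_id.
apply: lnorm_le => //; first exact: measurable_normf.
by apply: aeW => x; rewrite normr_id.
Qed.

Lemma inX0 : inX N (fun=> 0).
Proof.
have [w [hw _]] := ex_weak_unit; apply: (inX_le hw) => //.
by apply: aeW => x; rewrite normr0.
Qed.

Lemma lnorm0 : N (fun=> 0) = 0%E.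
Proof.
case: bl => _ [h _]; apply/h; first exact: measurable_cst.
exact: aeW.
Qed.

Lemma inX_fin f : inX N f -> N f \is a fin_num.
Proof. by move=> [mf Nf]; rewrite ge0_fin_numE// lnorm_ge0. Qed.

Lemma lnorm_small f : measurable_fun setT f ->
  (forall e : R, 0 < e -> (N f <= e%:E)%E) -> {ae mu, forall x, f x = 0}.
Proof.
move=> mf h; apply: lnorm_eq0 => //; apply/eqP.
rewrite eq_le lnorm_ge0// andbT; apply/lee_addgt0Pr => e e0.
by rewrite add0e; exact: h.
Qed.

(* [v] is the sum of the series of the 2^-(k+1) |u_k|. *)
Lemma ball_dominated (u : nat -> T -> R) : (forall n, inX N (u n)) ->
  (forall n, (N (u n) <= 1)%E) ->
  exists v, [/\ inX N v, (forall x, 0 <= v x) &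
    {ae mu, forall x n, `|u n x| <= 2 ^+ n.+1 * v x}].
Proof.
move=> uX u1; pose s n x := \sum_(k < n) (2^-1) ^+ k.+1 * `|u k x|.
have sS n x : s n.+1 x = s n x + (2^-1) ^+ n.+1 * `|u n x|.
  by rewrite /s big_ord_recr.
have sX n : inX N (s n).
  elim: n => [|n IH].
    rewrite (_ : s 0%N = fun=> 0); first exact: inX0.
    by apply/funext => x; rewrite /s big_ord0.
  rewrite (_ : s n.+1 = fun x => s n x + (2^-1) ^+ n.+1 * `|u n x|).
    by apply: inXD => //; apply: inXZ; exact: inX_norm.
  by apply/funext => x; rewrite sS.
have ms n : measurable_fun setT (s n) by case: (sX n).
have s_nd x n m : (n <= m)%N -> s n x <= s m x.
  move=> /subnKC <-; elim: (m - n)%N => [|k IH]; first by rewrite addn0.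
  by rewrite addnS sS; apply: ler_wpDr => //; rewrite mulr_ge0 ?exprn_ge0.
(* The [u k] lie in the unit ball, so the increments are bounded by the terms of a geometric series,
   whose partial sum is the right-hand side. *)
have sB n m : (n <= m)%N ->
    (N (fun x => (s m x - s n x)%R) <= ((2^-1) ^+ n - (2^-1) ^+ m)%:E)%E.
  move=> /subnKC <-; elim: (m - n)%N => [|k IH].
    rewrite addn0 subrr (_ : (fun x => _) = fun=> 0) ?lnorm0//.
    by apply/funext => x; rewrite subrr.
  rewrite addnS (_ : (fun x => _) = (fun x => (s (n + k)%N x - s n x) +
     (2^-1) ^+ (n + k).+1 * `|u (n + k)%N x|)); last first.
    by apply/funext => x; rewrite sS; ring.
  have mu' : measurable_fun setT (fun x => `|u (n + k)%N x|).
    by apply: measurable_normf; case: (uX (n + k)%N).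
  apply: (le_trans (lnormD (measurable_subf (ms _) (ms _)) (measurable_scalef _ mu'))).
  rewrite lnormZ// lnorm_abs; last by case: (uX (n + k)%N).
  have -> : (2^-1) ^+ n - (2^-1) ^+ (n + k).+1 = ((2^-1) ^+ n - (2^-1) ^+ (n + k))
      + (2^-1) ^+ (n + k).+1 :> R by rewrite exprS; field.
  rewrite EFinD; apply: leeD => //.
  rewrite ger0_norm ?exprn_ge0//.
  rewrite -[leRHS]mule1; by apply: lee_wpmul2l => //; rewrite lee_fin exprn_ge0.
have [f [fX sf]] : exists f, inX N f /\
    (fun n => N (fun x => s n x - f x)) @ \oo --> 0%E.
  apply: lnorm_complete => // e e0.
  have [n0 hn0] : exists n0, (2^-1) ^+ n0 < e.
    have := @cvg_geometric R 1 (2^-1); rewrite /geometric /=.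
    move=> /(_ _)/cvgrPdist_lt.
    rewrite ger0_norm// invf_lt1 ?ltr1n// => /(_ isT _ e0)[n0 _ /(_ n0)].
    rewrite /= => /(_ (leqnn _)); rewrite mul1r sub0r normrN ger0_norm ?exprn_ge0//.
    by exists n0.
  exists n0 => n m; wlog nm : n m / (n <= m)%N.
    move=> H n0n n0m; case/orP: (leq_total n m) => [nm|mn]; first exact: (H n m).
    rewrite (_ : (fun x => _) = (fun x => -1 * (s m x - s n x))).
      rewrite lnormZ ?normrN1 ?mul1e; last exact: measurable_subf.
      exact: (H m n mn).
    by apply/funext => x; ring.
  move=> n0n _; rewrite (_ : (fun x => _) = (fun x => -1 * (s m x - s n x))).
    rewrite lnormZ ?normrN1 ?mul1e; last exact: measurable_subf.
    apply: le_lt_trans (sB _ _ nm) _; rewrite lte_fin.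
    have : (2^-1 : R) ^+ n <= 2^-1 ^+ n0.
      by apply: ler_wiXn2l => //; rewrite invf_le1// ler1n.
    have : 0 <= (2^-1 : R) ^+ m by rewrite exprn_ge0.
    by lra.
  by apply/funext => x; ring.
exists (fun x => `|f x|); split => //; first exact: inX_norm.
have mf : measurable_fun setT f by case: fX.
apply: ae_foralln => n.
(* Only norm convergence to [f] is known. For [m > n] the positive part of [s n.+1 - f] is dominated
   by [s m - f], whose norm tends to 0, so it vanishes a.e. *)
have : {ae mu, forall x, Num.max (s n.+1 x - f x) 0 = 0}.
  apply: lnorm_small => [|e e0].
    by apply: measurable_maxf => //; exact: measurable_subf.
  move/fine_cvgP: sf => [sfin /cvgrPdist_lt/(_ _ e0) sf].
  have [m [mn h1 h2]] : exists m, [/\ (n < m)%N,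
     N (fun x => s m x - f x) \is a fin_num &
     fine (N (fun x => s m x - f x)) < e].
    case: sfin => m1 _ h1; case: sf => m2 _ h2.
    exists (maxn n.+1 (maxn m1 m2)); split; first by rewrite leq_maxl.
      by apply: h1 => /=; rewrite !leq_max leqnn orbT.
    have := h2 (maxn n.+1 (maxn m1 m2)); rewrite /= sub0r normrN => /(_ _).
    move=> H; apply: le_lt_trans (ler_norm _) _; apply: H.
    by rewrite !leq_max leqnn !orbT.
  apply: (@le_trans _ _ (N (fun x => s m x - f x))); last first.
    by rewrite -(fineK h1) lee_fin ltW.
  apply: lnorm_le; first by apply: measurable_maxf => //; exact: measurable_subf.
    exact: measurable_subf.
  apply: aeW => x; have := s_nd x _ _ mn.
  rewrite /Num.max; case: ifPn => [_ _|]; first by rewrite normr0.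
  rewrite -leNgt => h sm; rewrite ger0_norm//.
  by apply: le_trans (ler_norm _); lra.
apply: filterS => x h.
have {h} : s n.+1 x <= f x by move: h; rewrite /Num.max; case: ifPn; lra.
rewrite sS => h.
have s0 : 0 <= s n x.
  by apply: le_trans (s_nd x 0%N n (leq0n _)); rewrite /s big_ord0.
have : (2^-1) ^+ n.+1 * `|u n x| <= `|f x| by have := ler_norm (f x); lra.
rewrite exprVn mulrC ler_pdivrMr ?exprn_gt0//; lra.
Qed.

End BanachLattice.

(** * Countable families of a.e. statements and monotone limits *)

Section AlmostEverywhere.
Context {R : realType} d (T : measurableType d) (mu : {measure set T -> \bar R}).

(** The rationals are enumerated through [pickle], which leaves a countable union of null sets. It
    serves the rational scales in [op_geomean]. *)
Lemma ae_forall_rat (P : rat -> T -> Prop) :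
  (forall q, {ae mu, forall x, P q x}) -> {ae mu, forall x q, P q x}.
Proof.
move=> h; have : {ae mu, forall x (n : nat),
    if unpickle n is Some q then P q x else True}.
  by apply: ae_foralln => n; case: unpickle => [q|]; [exact: h|exact: aeW].
by apply: filterS => x H q; have := H (pickle q); rewrite pickleK.
Qed.

(** Extended values make the supremum exist and be measurable before anything is known about
    boundedness. *)
Definition seq_sup (f : nat -> T -> R) x := ereal_sup (range (fun n => (f n x)%:E)).

Lemma measurable_seq_sup (f : nat -> T -> R) :
  (forall n, measurable_fun setT (f n)) -> measurable_fun setT (seq_sup f).
Proof.
move=> mf; rewrite (_ : seq_sup f = fun x => esups (fun n => (f n x)%:E) 0%N).
  by apply: (@measurable_fun_esups _ _ _ setT (fun n x => (f n x)%:E)) => n;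
     exact/measurable_EFinP.
apply/funext => x; rewrite /seq_sup /esups /sdrop /=; congr ereal_sup.
by apply/seteqP; split => _ [n _ <-]; exists n.
Qed.

Lemma seq_sup_cvg (f : nat -> T -> R) x : (forall n, f n x <= f n.+1 x) ->
  seq_sup f x != +oo%E ->
  (forall n, f n x <= fine (seq_sup f x)) /\
  f ^~ x @ \oo --> fine (seq_sup f x).
Proof.
move=> f_nd fin.
have ub n : ((f n x)%:E <= seq_sup f x)%E by apply: ereal_sup_ubound; exists n.
have fS : seq_sup f x \is a fin_num.
  by rewrite fin_numE fin andbT; apply/eqP => h; have := ub 0%N; rewrite h.
split=> [n|]; first by rewrite -lee_fin fineK.
have nd : {homo (fun n => (f n x)%:E) : n m / (n <= m)%N >-> (n <= m)%E}.
  by apply: homo_leq => [?|? ? ?|n]; [exact: lexx|exact: le_trans|rewrite lee_fin].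
by move: (ereal_nondecreasing_cvgn nd); rewrite -/(seq_sup f x) -(fineK fS) => /fine_cvgP[].
Qed.

Lemma ae_nondecreasing_lim (f : nat -> T -> R) :
  (forall n, measurable_fun setT (f n)) ->
  {ae mu, forall x n, f n x <= f n.+1 x} ->
  {ae mu, forall x, exists M, forall n, f n x <= M} ->
  exists F, [/\ measurable_fun setT F, {ae mu, forall x n, f n x <= F x} &
    {ae mu, forall x, f ^~ x @ \oo --> F x}].
Proof.
move=> mf f_nd f_bd; exists (fun x => fine (seq_sup f x)).
have fin : {ae mu, forall x, seq_sup f x != +oo%E}.
  apply: filterS f_bd => x [M hM]; rewrite -ltey.
  apply: (@le_lt_trans _ _ M%:E); last exact: ltry.
  by apply: ge_ereal_sup => _ [n _ <-]; rewrite lee_fin.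
split.
- apply: (measurableT_comp (fine_measurable measurableT)).
  exact: measurable_seq_sup.
- by apply: filterS2 f_nd fin => x h1 h2; case: (seq_sup_cvg h1 h2).
- by apply: filterS2 f_nd fin => x h1 h2; case: (seq_sup_cvg h1 h2).
Qed.

End AlmostEverywhere.

(** * From norm bounds to pointwise bounds *)

Section FatouLattice.
Context {R : realType} d (T : measurableType d) (mu : {measure set T -> \bar R}).
Context (N : (T -> R) -> \bar R) (bl : banach_lattice mu N).

(* [fatou_property] presupposes a finite limit; here finiteness a.e. is
   obtained by truncating at the multiples of a weak unit. *)
Lemma fatou_bounded (f : nat -> T -> R) (M : R) : fatou_property mu N ->
  (forall n, inX N (f n)) ->
  {ae mu, forall x n, 0 <= f n x /\ f n x <= f n.+1 x} ->
  (forall n, (N (f n) <= M%:E)%E) ->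
  exists F, [/\ inX N F, (N F <= M%:E)%E & {ae mu, forall x n, f n x <= F x}].
Proof.
move=> fatou fX f_nd fM.
have [w [wX w0]] := ex_weak_unit bl; have mw : measurable_fun setT w by case: wX.
have mf n : measurable_fun setT (f n) by case: (fX n).
pose b x := seq_sup f x == +oo%E.
have mb : measurable_fun setT b.
  by apply: measurable_fun_eqe; [exact: measurable_seq_sup|exact: measurable_cst].
pose wb x := if b x then w x else 0.
have mwb : measurable_fun setT wb by exact: measurable_if0.
have M0 : 0 <= M by rewrite -lee_fin; apply: le_trans (fM 0%N); exact: (lnorm_ge0 bl).
(* [b] marks the points with infinite supremum. There [f n x] eventually exceeds [k * w x], so the
   truncations [q n] increase to the finite function [k * wb], to which the Fatou property
   applies. *)
have wbM (k : nat) : (k%:R%:E * N wb <= M%:E)%E.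
  pose q n x := if b x then Num.min (f n x) (k%:R * w x) else 0.
  have mq n : measurable_fun setT (q n).
    by apply: measurable_if0 => //; apply: measurable_minf => //; exact: measurable_scalef.
  have qf n : {ae mu, forall x, `|q n x| <= `|f n x|}.
    apply: filterS2 f_nd w0 => x h1 wx; have [f0 _] := h1 n.
    rewrite /q; case: ifP => _; last by rewrite normr0.
    have kw : 0 <= k%:R * w x by rewrite mulr_ge0// ltW.
    by rewrite !ger0_norm// ?ge_min ?lexx// le_min f0.
  have qX n : inX N (q n) by apply: (inX_le bl (fX n)).
  have [||||] := fatou q (fun x => k%:R * wb x) qX.
  - exact: measurable_scalef.
  - apply: filterS2 f_nd w0 => x h1 wx n; have [f0 fn] := h1 n.
    have kw : 0 <= k%:R * w x by rewrite mulr_ge0// ltW.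
    rewrite /q; case: ifP => _ //; split; first by rewrite le_min f0.
    by rewrite le_min !ge_min fn lexx orbT.
  - apply: filterS f_nd => x h1; rewrite /q /wb; case: ifPn => bx; last first.
      by rewrite mulr0; exact: cvg_cst.
    apply: cvg_near_cst.
    have [n hn] : exists n, k%:R * w x <= f n x.
      apply: contrapT => H; move/eqP: bx.
      have : (seq_sup f x <= (k%:R * w x)%:E)%E.
        apply: ge_ereal_sup => _ [n _ <-]; rewrite lee_fin leNgt.
        by apply/negP => h; apply: H; exists n; exact: ltW.
      by move=> + E; rewrite E.
    exists n => // m /= nm; apply/min_idPr; apply: le_trans hn _.
    elim: m nm => [|m IH]; first by rewrite leqn0 => /eqP ->.
    rewrite leq_eqVlt ltnS => /predU1P[->//|/IH/le_trans]; apply.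
    by case: (h1 m).
  - by exists M => n; apply: le_trans (fM n); apply: (lnorm_le bl).
  - move=> _ Ncv; rewrite -[k%:R]ger0_norm// -(lnormZ bl)//; apply: cvge_le Ncv.
    by apply: nearW => n; apply: le_trans (fM n); apply: (lnorm_le bl).
have bF : {ae mu, forall x, b x = false}.
  (* [N wb <= M / k] for every positive [k] forces [wb = 0] a.e.; as [w > 0] a.e., the set marked by
     [b] is null. *)
  have : {ae mu, forall x, wb x = 0}.
    apply: (lnorm_small bl) => // e e0.
    have wbfin : N wb \is a fin_num.
      apply: (inX_fin bl); apply: (inX_le bl wX) => //; apply: aeW => x.
      by rewrite /wb; case: ifP => // _; rewrite normr0.
    have := wbM (Num.truncn (M / e)).+1; rewrite -(fineK wbfin) -EFinM !lee_fin.
    have : M / e < (Num.truncn (M / e)).+1%:R by exact: truncnS_gt.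
    set k := (X in X%:R); have k0 : 0 < k%:R :> R by rewrite ltr0n.
    rewrite ltr_pdivrMr// => h1 h2.
    rewrite leNgt; apply/negP => h3; have := ltr_pM2l k0 e (fine (N wb)).
    rewrite h3; lra.
  apply: filterS2 w0 => x wx; rewrite /wb; case: ifP => // _ h.
  by move: wx; rewrite h ltxx.
have f_nd' : {ae mu, forall x n, f n x <= f n.+1 x}.
  by apply: filterS f_nd => x h n; case: (h n).
have f_cv : {ae mu, forall x, (forall n, f n x <= fine (seq_sup f x)) /\
    f ^~ x @ \oo --> fine (seq_sup f x)}.
  by apply: filterS2 f_nd' bF => x h1 /negbT h2; exact: seq_sup_cvg.
have [||||FX] := fatou f (fun x => fine (seq_sup f x)) fX.
- apply: (measurableT_comp (fine_measurable measurableT)).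
  exact: measurable_seq_sup.
- exact: f_nd.
- by apply: filterS f_cv => x [].
- by exists M.
- move=> Ncv; exists (fun x => fine (seq_sup f x)); split => //.
    by apply: cvge_le Ncv; exact: nearW.
  by apply: filterS f_cv => x [].
Qed.

(** The pointwise infimum [z] of the [|v n|] lies below each of them, so its norm is arbitrarily
    small and [z = 0] a.e. No subsequence has to be extracted. *)
Lemma ae_small (v : nat -> T -> R) : (forall n, measurable_fun setT (v n)) ->
  (forall e : R, 0 < e -> exists n, (N (v n) <= e%:E)%E) ->
  {ae mu, forall x (e : R), 0 < e -> exists n, v n x <= e}.
Proof.
move=> mv vs; pose z x := infs (fun n => `|v n x|) 0%N.
have lb x : has_lbound (range (fun n => `|v n x|)) by exists 0 => _ [n _ <-].
have zv x n : 0 <= z x /\ z x <= `|v n x|.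
  rewrite /z /infs /sdrop /=; split.
    apply: lb_le_inf; first by exists `|v 0%N x|; exists 0%N.
    by move=> _ [k _ <-].
  by apply: ge_inf; [exists 0 => _ [k _ <-]|exists n].
have mz : measurable_fun setT z.
  apply: (@measurable_fun_infs _ _ _ setT (fun n x => `|v n x|)) => // n.
  exact: measurable_normf.
have : {ae mu, forall x, z x = 0}.
  apply: (lnorm_small bl) => // e /vs[n]; apply: le_trans.
  apply: (lnorm_le bl) => //; apply: aeW => x; have [z0 zn] := zv x n.
  by rewrite ger0_norm.
apply: filterS => x zx e e0.
apply: contrapT => H; suff : e <= z x by rewrite zx; lra.
rewrite /z /infs /sdrop /=; apply: lb_le_inf.
  by exists `|v 0%N x|; exists 0%N.
move=> _ [k _ <-]; apply: le_trans (ler_norm _); rewrite leNgt; apply/negP => h.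
by apply: H; exists k; exact: ltW.
Qed.

End FatouLattice.

(** * Weighted geometric means of real numbers *)

Section GeometricMean.
Context {R : realType}.
Implicit Types a b c r t : R.

Definition geomean t a b := a `^ (1 - t) * b `^ t.

Lemma geomean_ge0 t a b : 0 <= geomean t a b.
Proof. by rewrite mulr_ge0 ?powR_ge0. Qed.

Lemma geomeanC t a b : geomean (1 - t) a b = geomean t b a.
Proof. by rewrite /geomean mulrC; congr (_ * _ `^ _); ring. Qed.

Section Exponent.
Context (t : R) (t01 : 0 < t < 1).

Let t0 : 0 < t. Proof. by case/andP: t01. Qed.
Let t1 : 0 < 1 - t. Proof. by case/andP: t01; rewrite subr_gt0. Qed.

Lemma le_geomean a b a' b' : 0 <= a -> 0 <= b -> a <= a' -> b <= b' ->
  geomean t a b <= geomean t a' b'.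
Proof.
move=> a0 b0 aa bb; apply: ler_pM; rewrite ?powR_ge0//.
  by apply: ge0_ler_powR => //; rewrite ?nnegrE ?(ltW t1) ?(le_trans a0).
by apply: ge0_ler_powR => //; rewrite ?nnegrE ?(ltW t0) ?(le_trans b0).
Qed.

Lemma geomeanM a b c c' : 0 <= a -> 0 <= b -> 0 <= c -> 0 <= c' ->
  geomean t (c * a) (c' * b) = geomean t c c' * geomean t a b.
Proof. by move=> *; rewrite /geomean !powRM//; ring. Qed.

Lemma geomean_id c : 0 <= c -> geomean t c c = c.
Proof.
move=> c0; rewrite /geomean -powRD ?subrK ?powRr1//.
by apply/implyP; rewrite oner_eq0.
Qed.

Lemma geomeanZ a b c : 0 <= a -> 0 <= b -> 0 <= c ->
  geomean t (c * a) (c * b) = c * geomean t a b.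
Proof. by move=> *; rewrite geomeanM// geomean_id. Qed.

Lemma geomean_le_add a b : 0 <= a -> 0 <= b -> geomean t a b <= a + b.
Proof.
move=> a0 b0; have t1' : 1 - t <= 1 by move: t0; lra.
have t0' : t <= 1 by move: t1; lra.
(* Young's inequality with the conjugate exponents [1/(1-t)] and [1/t]; the weights [1-t] and [t] it
   produces are then bounded by 1. *)
have := @conjugate_powR R (a `^ (1 - t)) (b `^ t) (1 - t)^-1 t^-1.
rewrite -!powRrM !divff ?gt_eqF// !powRr1// !invrK.
move=> /(_ (powR_ge0 _ _) (powR_ge0 _ _)); rewrite !invr_gt0 => /(_ t1 t0).
move=> /(_ _) H; apply: le_trans (H _) _; first by ring.
by apply: lerD; rewrite ler_piMr.
Qed.

(** Scaling by [r^t] and [r^(t-1)] leaves the mean unchanged, because [t(1-t) + (t-1)t = 0]. *)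
Lemma geomean_scale_le r a b : 0 < r -> 0 <= a -> 0 <= b ->
  geomean t a b <= r `^ t * a + r `^ (t - 1) * b.
Proof.
move=> r0 a0 b0; apply: le_trans (geomean_le_add _ _); last 2 first.
  by rewrite mulr_ge0 ?powR_ge0.
  by rewrite mulr_ge0 ?powR_ge0.
rewrite geomeanM ?powR_ge0// {2}/geomean -!powRrM -powRD; last first.
  by apply/implyP => _; rewrite gt_eqF.
by rewrite (_ : _ + _ = 0) ?powRr0 ?mul1r//; ring.
Qed.

Lemma geomean_gt0r a b : 0 <= b -> 0 < geomean t a b -> 0 < b.
Proof.
move=> b0 h; rewrite lt_neqAle b0 andbT; apply/eqP => bE; move: h.
by rewrite -bE /geomean powR0 ?gt_eqF// mulr0 ltxx.
Qed.

Lemma geomean_gt0 a b : 0 < a -> 0 < b -> 0 < geomean t a b.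
Proof. by move=> a0 b0; rewrite mulr_gt0 ?powR_gt0. Qed.

(** Converse of [geomean_scale_le]. At the scale [r = b/a] both summands equal the mean; a rational
    [q] between [r/2] and [r] keeps the first below the mean and at most doubles the second, whence
    [3 = 1 + 2]. *)
Lemma geomean_inf a b c : 0 <= a -> 0 <= b ->
  (forall q : rat, 0 < ratr q :> R ->
     c <= ratr q `^ t * a + ratr q `^ (t - 1) * b) ->
  c <= 3 * geomean t a b.
Proof.
move=> a0 b0 H.
have tn0 : t != 0 by rewrite gt_eqF.
have tn1 : 1 - t != 0 by rewrite gt_eqF.
(* With [a = 0] the mean vanishes; a large [q] makes [q^(t-1) * b] smaller than any [c > 0]. *)
have [aE|an0] := eqVneq a 0.
  rewrite /geomean aE powR0// mul0r mulr0 leNgt; apply/negP => c0.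
  pose x := ((b + 1) / c) `^ (1 - t)^-1.
  have x0 : 0 <= x by exact: powR_ge0.
  have /rat_in_itvoo[q] : x < x + 1 by rewrite ltrDl.
  rewrite in_itv/= => /andP[xq _].
  have q0 : 0 < ratr q :> R by exact: le_lt_trans xq.
  have := H q q0; rewrite aE mulr0 add0r (_ : t - 1 = - (1 - t)); last by ring.
  have qt0 := powR_gt0 (1 - t) q0.
  rewrite powRN mulrC ler_pdivlMr//; apply/negP; rewrite -ltNge.
  have : x `^ (1 - t) <= ratr q `^ (1 - t).
    by apply: ge0_ler_powR; rewrite ?nnegrE//; apply: ltW.
  rewrite -powRrM mulVf// powRr1; last by rewrite divr_ge0 ?(ltW c0)// addr_ge0.
  by rewrite ler_pdivrMr// => h; lra.
have {an0}a_gt0 : 0 < a by rewrite lt_neqAle eq_sym an0.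
(* Symmetrically, a small [q] makes [q^t * a] smaller than any [c > 0]. *)
have [bE|bn0] := eqVneq b 0.
  rewrite /geomean bE powR0// mulr0 mulr0 leNgt; apply/negP => c0.
  pose x := (c / (a + 1)) `^ t^-1.
  have ca : 0 < c / (a + 1) by rewrite divr_gt0// addr_gt0.
  have x0 : 0 < x by exact: powR_gt0.
  have [q] := @rat_in_itvoo R 0 x x0.
  rewrite in_itv/= => /andP[q0 qx].
  have := H q q0; rewrite bE mulr0 addr0; apply/negP; rewrite -ltNge.
  have : ratr q `^ t <= x `^ t.
    by apply: ge0_ler_powR; rewrite ?nnegrE//; apply: ltW.
  rewrite -powRrM mulVf// powRr1; last exact: ltW.
  rewrite ler_pdivlMr ?addr_gt0// => h.
  have := powR_gt0 t q0; lra.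
have {bn0}b_gt0 : 0 < b by rewrite lt_neqAle eq_sym bn0.
pose s := b / a; have s0 : 0 < s by rewrite divr_gt0.
have /rat_in_itvoo[q] : s / 2 < s by lra.
rewrite in_itv/= => /andP[sq qs].
have q0 : 0 < ratr q :> R by lra.
apply: le_trans (H q q0) _.
have E1 : s `^ t * a = geomean t a b.
  rewrite /s /geomean powRM ?invr_ge0// -powR_inv1// -powRrM mulN1r.
  rewrite mulrAC [RHS]mulrC -mulrA; congr (_ * _).
  by rewrite -{1}(powRr1 a0) -powRD//; apply/implyP => _; rewrite gt_eqF.
have E2 : s `^ (t - 1) * b = geomean t a b.
  rewrite -E1 powRD; last by apply/implyP => _; rewrite gt_eqF.
  by rewrite powR_inv1 ?ltW// /s invf_div -!mulrA mulVf ?mulr1 ?gt_eqF.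
have h1 : ratr q `^ t * a <= geomean t a b.
  rewrite -E1 ler_wpM2r//; by apply: ge0_ler_powR; rewrite ?nnegrE//; apply: ltW.
have h2 : ratr q `^ (t - 1) * b <= 2 * geomean t a b.
  rewrite -E2 mulrA ler_wpM2r// (_ : t - 1 = - (1 - t)); last by ring.
  rewrite !powRN -[leLHS]mul1r ler_pdivrMr ?powR_gt0// mulrAC.
  rewrite ler_pdivlMr ?powR_gt0// mul1r.
  apply: (@le_trans _ _ ((2 * ratr q) `^ (1 - t))).
    by apply: ge0_ler_powR; rewrite ?nnegrE; move: t1; lra.
  rewrite powRM//; last exact: ltW.
  by rewrite ler_wpM2r ?powR_ge0// ler1_powR ?ler1n//; move: t0; lra.
lra.
Qed.

End Exponent.
End GeometricMean.

(** * The sum of a couple and its Calderon products as solid spaces *)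

Section Sum.
Context {R : realType} d (T : measurableType d) (mu : {measure set T -> \bar R}).

Lemma inSum_swap (N0 N1 : (T -> R) -> \bar R) f :
  inSum mu N0 N1 f -> inSum mu N1 N0 f.
Proof.
move=> [mf [f0 [f1 [h0 h1 h]]]]; split=> //; exists f1, f0; split => //.
by apply: filterS h => x ->; rewrite addrC.
Qed.

Context (X0 X1 : (T -> R) -> \bar R).
Context (bl0 : banach_lattice mu X0) (bl1 : banach_lattice mu X1).
Implicit Types f g p : T -> R.

Lemma inSum_le_add f p0 p1 : measurable_fun setT f -> inX X0 p0 -> inX X1 p1 ->
  {ae mu, forall x, `|f x| <= `|p0 x| + `|p1 x|} -> inSum mu X0 X1 f.
Proof.
move=> mf h0 h1 h; split=> //.
(* Riesz decomposition: [f] is clamped to the interval from [-|p0|] to [|p0|], and what remains is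
   at most [|p1|] in modulus. *)
pose g0 x := Num.max (- `|p0 x|) (Num.min (f x) `|p0 x|).
have mp0 : measurable_fun setT (fun x => `|p0 x|) by apply: measurable_normf; case: h0.
have mg0 : measurable_fun setT g0.
  exact: (measurable_maxf (measurable_oppf mp0) (measurable_minf mf mp0)).
exists g0, (fun x => f x - g0 x); split.
- apply: (inX_le bl0 h0) => //; apply: aeW => x; rewrite ler_norml /g0.
  rewrite le_max ge_max ge_min !lexx orbT/= andbT.
  by have := normr_ge0 (p0 x); lra.
- apply: (inX_le bl1 h1) => //; first exact: measurable_subf.
  apply: filterS h => x; rewrite /g0 /Num.max /Num.min !ler_norml => h.
  by have := normr_ge0 (p0 x); have := normr_ge0 (p1 x); move: h;
     case: ifPn; case: ifPn; rewrite -?leNgt; lra.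
- by apply: aeW => x; rewrite addrC subrK.
Qed.

Lemma inSum_le f g : inSum mu X0 X1 g -> measurable_fun setT f ->
  {ae mu, forall x, `|f x| <= `|g x|} -> inSum mu X0 X1 f.
Proof.
move=> [mg [g0 [g1 [h0 h1 h]]]] mf fg; apply: (inSum_le_add mf h0 h1).
by apply: filterS2 h fg => x -> /le_trans; apply; exact: ler_normD.
Qed.

Lemma inSum0 f : inX X0 f -> inSum mu X0 X1 f.
Proof.
move=> hf; apply: (inSum_le_add _ hf (inX0 bl1)); first by case: hf.
by apply: aeW => x; rewrite normr0 addr0.
Qed.

Lemma inSum1 f : inX X1 f -> inSum mu X0 X1 f.
Proof.
move=> hf; apply: (inSum_le_add _ (inX0 bl0) hf); first by case: hf.
by apply: aeW => x; rewrite normr0 add0r.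
Qed.

Lemma inSum_lin a b f g : inSum mu X0 X1 f -> inSum mu X0 X1 g ->
  inSum mu X0 X1 (fun x => a * f x + b * g x).
Proof.
move=> [mf [f0 [f1 [hf0 hf1 hf]]]] [mg [g0 [g1 [hg0 hg1 hg]]]].
split; first by apply: measurable_addf; exact: measurable_scalef.
exists (fun x => a * f0 x + b * g0 x), (fun x => a * f1 x + b * g1 x); split.
- by apply: (inXD bl0); exact: (inXZ bl0).
- by apply: (inXD bl1); exact: (inXZ bl1).
- by apply: filterS2 hf hg => x -> ->; ring.
Qed.

Lemma inSumD f g : inSum mu X0 X1 f -> inSum mu X0 X1 g ->
  inSum mu X0 X1 (fun x => f x + g x).
Proof.
move=> hf hg; have := inSum_lin 1 1 hf hg.
by congr inSum; apply/funext => x; ring.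
Qed.

Lemma inSumB f g : inSum mu X0 X1 f -> inSum mu X0 X1 g ->
  inSum mu X0 X1 (fun x => f x - g x).
Proof.
move=> hf hg; have := inSum_lin 1 (-1) hf hg.
by congr inSum; apply/funext => x; ring.
Qed.

Lemma inSumZ a f : inSum mu X0 X1 f -> inSum mu X0 X1 (fun x => a * f x).
Proof.
move=> hf; have := inSum_lin a 0 hf hf.
by congr inSum; apply/funext => x; ring.
Qed.

Lemma inSum_norm f : inSum mu X0 X1 f -> inSum mu X0 X1 (fun x => `|f x|).
Proof.
move=> hf; apply: (inSum_le hf); first by apply: measurable_normf; case: hf.
by apply: aeW => x; rewrite normr_id.
Qed.

Lemma measurable_geomean t f g : measurable_fun setT f -> measurable_fun setT g ->
  measurable_fun setT (fun x => geomean t (f x) (g x)).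
Proof. by move=> mf mg; apply: measurable_mulf; exact: measurable_powRf. Qed.

Context (t : R) (t01 : 0 < t < 1).

Lemma inSum_geomean_le f f0 f1 : measurable_fun setT f ->
  inX X0 f0 -> inX X1 f1 -> (forall x, 0 <= f0 x) -> (forall x, 0 <= f1 x) ->
  {ae mu, forall x, `|f x| <= geomean t (f0 x) (f1 x)} -> inSum mu X0 X1 f.
Proof.
move=> mf h0 h1 p0 p1 h; apply: (inSum_le_add mf h0 h1).
apply: filterS h => x /le_trans; apply; rewrite !ger0_norm//.
exact: geomean_le_add.
Qed.

(** By homogeneity of the mean the scalar and the normalisations can be absorbed into the two
    factors, which may also be taken nonnegative everywhere. Membership is used in this form from
    here on. *)
Lemma calderon_ltyP f : (calderon mu X0 X1 t f < +oo)%E <->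
  exists f0 f1, [/\ inX X0 f0, inX X1 f1, (forall x, 0 <= f0 x),
    (forall x, 0 <= f1 x) & {ae mu, forall x, `|f x| <= geomean t (f0 x) (f1 x)}].
Proof.
split.
  move=> /ereal_inf_lt[_ [l [l0 [f0 [f1 [h0 h1 _ _ h]]]] <-] _].
  exists (fun x => l * `|f0 x|), (fun x => l * `|f1 x|); split.
  - by apply: (inXZ bl0); exact: (inX_norm bl0).
  - by apply: (inXZ bl1); exact: (inX_norm bl1).
  - by move=> x; rewrite mulr_ge0// ltW.
  - by move=> x; rewrite mulr_ge0// ltW.
  - by apply: filterS h => x; rewrite geomeanZ// ltW.
move=> [f0 [f1 [h0 h1 p0 p1 h]]].
(* Positive and at least both norms, so one division puts both factors in the unit balls. *)
pose M := 1 + fine (X0 f0) + fine (X1 f1).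
have m0 : measurable_fun setT f0 by case: h0.
have m1 : measurable_fun setT f1 by case: h1.
have n0 : 0 <= fine (X0 f0) by rewrite fine_ge0// (lnorm_ge0 bl0).
have n1 : 0 <= fine (X1 f1) by rewrite fine_ge0// (lnorm_ge0 bl1).
have M0 : 0 < M by rewrite /M; lra.
apply: (@le_lt_trans _ _ M%:E); last exact: ltry.
apply: ereal_inf_lbound; exists M => //; split => //.
exists (fun x => M^-1 * f0 x), (fun x => M^-1 * f1 x); split.
- exact: (inXZ bl0).
- exact: (inXZ bl1).
- rewrite (lnormZ bl0)// -(fineK (inX_fin bl0 h0)) -EFinM lee_fin.
  rewrite ger0_norm ?invr_ge0 ?(ltW M0)// mulrC ler_pdivrMr// mul1r /M; lra.
- rewrite (lnormZ bl1)// -(fineK (inX_fin bl1 h1)) -EFinM lee_fin.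
  rewrite ger0_norm ?invr_ge0 ?(ltW M0)// mulrC ler_pdivrMr// mul1r /M; lra.
- apply: filterS h => x /le_trans; apply.
  have M1 : 0 <= M^-1 by rewrite invr_ge0 ltW.
  rewrite -/(geomean t _ _) !ger0_norm ?mulr_ge0// geomeanZ//.
  by rewrite mulrA divff ?mul1r// gt_eqF.
Qed.

Lemma calderon_inSum f : measurable_fun setT f ->
  (calderon mu X0 X1 t f < +oo)%E -> inSum mu X0 X1 f.
Proof.
move=> mf /calderon_ltyP[f0 [f1 [h0 h1 p0 p1 h]]].
exact: (inSum_geomean_le mf h0 h1).
Qed.

Lemma calderon_le f g : measurable_fun setT f ->
  {ae mu, forall x, `|f x| <= `|g x|} ->
  inX (calderon mu X0 X1 t) g -> inX (calderon mu X0 X1 t) f.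
Proof.
move=> mf fg [_ /calderon_ltyP[f0 [f1 [h0 h1 p0 p1 h]]]]; split=> //.
apply/calderon_ltyP; exists f0, f1; split => //.
by apply: filterS2 fg h => x; exact: le_trans.
Qed.

Lemma calderon_lin a b f g :
  inX (calderon mu X0 X1 t) f -> inX (calderon mu X0 X1 t) g ->
  inX (calderon mu X0 X1 t) (fun x => a * f x + b * g x).
Proof.
move=> [mf /calderon_ltyP[f0 [f1 [h0 h1 p0 p1 h]]]].
move=> [mg /calderon_ltyP[g0 [g1 [k0 k1 q0 q1 k]]]].
split; first by apply: measurable_addf; exact: measurable_scalef.
(* Both means lie below the mean of [f0 + g0] and [f1 + g1], so this single factor covers the two
   coefficients. *)
pose c := `|a| + `|b|; have c0 : 0 <= c by rewrite addr_ge0.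
apply/calderon_ltyP.
exists (fun x => c * (f0 x + g0 x)), (fun x => c * (f1 x + g1 x)); split.
- by apply: (inXZ bl0); exact: (inXD bl0).
- by apply: (inXZ bl1); exact: (inXD bl1).
- by move=> x; rewrite mulr_ge0 ?addr_ge0.
- by move=> x; rewrite mulr_ge0 ?addr_ge0.
apply: filterS2 h k => x h k; rewrite geomeanZ ?addr_ge0//.
apply: (le_trans (ler_normD _ _)); rewrite !normrM /c mulrDl; apply: lerD.
  apply: ler_wpM2l => //; apply: le_trans h _.
  by apply: le_geomean => //; rewrite ?lerDl.
apply: ler_wpM2l => //; apply: le_trans k _.
by apply: le_geomean => //; rewrite ?lerDr.
Qed.

Lemma calderon_unit : exists w, [/\ inX (calderon mu X0 X1 t) w,
  (forall x, 0 <= w x) & {ae mu, forall x, 0 < w x}].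
Proof.
have [w0 [h0 p0]] := ex_weak_unit bl0; have [w1 [h1 p1]] := ex_weak_unit bl1.
have k0 := inX_norm bl0 h0; have k1 := inX_norm bl1 h1.
exists (fun x => geomean t `|w0 x| `|w1 x|); split.
- split; first by apply: measurable_geomean; [case: k0|case: k1].
  apply/calderon_ltyP; exists (fun x => `|w0 x|), (fun x => `|w1 x|).
  by split=> //; apply: aeW => x; rewrite ger0_norm// geomean_ge0.
- by move=> x; exact: geomean_ge0.
- by apply: filterS2 p0 p1 => x x0 x1; rewrite geomean_gt0 ?normr_gt0 ?gt_eqF.
Qed.

End Sum.

(** Used to deduce the endpoint 1 from the endpoint 0. *)
Lemma calderon_swap (R : realType) d (T : measurableType d)
  (mu : {measure set T -> \bar R}) (X0 X1 : (T -> R) -> \bar R) t :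
  calderon mu X1 X0 (1 - t) = calderon mu X0 X1 t.
Proof.
apply/funext => f; congr ereal_inf; apply/seteqP.
split=> _ [l [l0 [f0 [f1 [h0 h1 n0 n1 h]]]] <-]; exists l => //; split=> //;
  exists f1, f0; split=> //; apply: filterS h => x;
  rewrite -!/(geomean _ _ _) geomeanC//.
Qed.

(** * Positive operators on a couple and on its Calderon products *)

Section PositiveOperator.
Context {R : realType} d1 d2 (S1 : measurableType d1) (S2 : measurableType d2).
Context (mu : {measure set S1 -> \bar R}) (nu : {measure set S2 -> \bar R}).
Context (X0 X1 : (S1 -> R) -> \bar R) (Y0 Y1 : (S2 -> R) -> \bar R).
Context (Top : (S1 -> R) -> (S2 -> R)).
Context (bX0 : banach_lattice mu X0) (bX1 : banach_lattice mu X1).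
Context (lin : linear_op mu nu X0 X1 Y0 Y1 Top).
Context (pos : positive_op mu nu X0 X1 Top).

Local Notation inS := (inSum mu X0 X1).

Lemma op_inSum f : inS f -> inSum nu Y0 Y1 (Top f).
Proof. by case: lin => + _ _; exact. Qed.

Lemma op_measurable f : inS f -> measurable_fun setT (Top f).
Proof. by move=> /op_inSum[]. Qed.

Lemma op_ae_eq f g : inS f -> inS g -> {ae mu, forall x, f x = g x} ->
  {ae nu, forall y, Top f y = Top g y}.
Proof. by case: lin => _ + _; exact. Qed.

Lemma opD f g : inS f -> inS g ->
  {ae nu, forall y, Top (fun x => f x + g x) y = Top f y + Top g y}.
Proof.
move=> hf hg; case: lin => _ _ /(_ 1 1 f g hf hg).
under [X in Top X]eq_fun do rewrite !mul1r.
by apply: filterS => y ->; ring.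
Qed.

Lemma opB f g : inS f -> inS g ->
  {ae nu, forall y, Top (fun x => f x - g x) y = Top f y - Top g y}.
Proof.
move=> hf hg; case: lin => _ _ /(_ 1 (-1) f g hf hg).
under [X in Top X]eq_fun do rewrite mul1r mulN1r.
by apply: filterS => y ->; ring.
Qed.

Lemma opZ a f : inS f ->
  {ae nu, forall y, Top (fun x => a * f x) y = a * Top f y}.
Proof.
move=> hf; case: lin => _ _ /(_ a 0 f f hf hf).
under [X in Top X]eq_fun do rewrite mul0r addr0.
by apply: filterS => y ->; ring.
Qed.

Lemma op_le f g : inS f -> inS g -> {ae mu, forall x, f x <= g x} ->
  {ae nu, forall y, Top f y <= Top g y}.
Proof.
move=> hf hg fg.
have : {ae nu, forall y, 0 <= Top (fun x => g x - f x) y}.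
  apply: pos; first exact: inSumB.
  by apply: filterS fg => x; rewrite subr_ge0.
by apply: filterS2 (opB hg hf) => y ->; rewrite subr_ge0.
Qed.

Lemma op_norm f : inS f ->
  {ae nu, forall y, `|Top f y| <= Top (fun x => `|f x|) y}.
Proof.
move=> hf; have hn := inSum_norm bX0 bX1 hf.
have h1 : {ae nu, forall y, Top f y <= Top (fun x => `|f x|) y}.
  by apply: op_le => //; apply: aeW => x; exact: ler_norm.
have : {ae nu, forall y, Top (fun x => -1 * `|f x|) y <= Top f y}.
  apply: op_le => //; first exact: inSumZ.
  by apply: aeW => x; rewrite mulN1r lerNl -normrN ler_norm.
by apply: filterS3 h1 (opZ (-1) hn) => y h1 -> h2; rewrite ler_norml; lra.
Qed.

Lemma op_ge0 f : inS f -> (forall x, 0 <= f x) ->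
  {ae nu, forall y, 0 <= Top f y}.
Proof. by move=> hf f0; apply: pos => //; exact: aeW. Qed.

Lemma inSum_sum n (f : nat -> S1 -> R) : (forall k, inS (f k)) ->
  inS (fun x => \sum_(k < n) f k x).
Proof.
move=> hf; elim: n => [|n IH].
  by under eq_fun do rewrite big_ord0; exact: (inSum0 bX0 bX1 (inX0 bX0)).
by under eq_fun do rewrite big_ord_recr; exact: inSumD.
Qed.

Lemma op_sum n (f : nat -> S1 -> R) : (forall k, inS (f k)) ->
  {ae nu, forall y, Top (fun x => \sum_(k < n) f k x) y = \sum_(k < n) Top (f k) y}.
Proof.
move=> hf; elim: n => [|n IH].
  under [X in Top X]eq_fun do rewrite big_ord0.
  have hz : inS (fun=> 0) by exact: (inSum0 bX0 bX1 (inX0 bX0)).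
  have := opZ 0 hz; under [X in Top X]eq_fun do rewrite mul0r.
  by apply: filterS => y ->; rewrite big_ord0 mul0r.
under [X in Top X]eq_fun do rewrite big_ord_recr.
by apply: filterS2 IH (opD (inSum_sum n hf) (hf n)) => y h ->;
  rewrite h big_ord_recr.
Qed.

Context (t : R) (t01 : 0 < t < 1).

(** The mean lies below linear combinations of [f0] and [f1], which a positive linear operator
    respects. Rational scales keep the exceptional null sets countable, and [geomean_inf] recovers
    the mean on the other side at the price of the factor 3. *)
Lemma op_geomean f0 f1 : inX X0 f0 -> inX X1 f1 -> (forall x, 0 <= f0 x) ->
  (forall x, 0 <= f1 x) ->
  {ae nu, forall y, Top (fun x => geomean t (f0 x) (f1 x)) y <=
    3 * geomean t (Top f0 y) (Top f1 y)}.
Proof.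
move=> h0 h1 p0 p1; have s0 := inSum0 bX0 bX1 h0; have s1 := inSum1 bX0 bX1 h1.
have sg : inS (fun x => geomean t (f0 x) (f1 x)).
  apply: (inSum_geomean_le bX0 bX1 t01 _ h0 h1) => //.
    by apply: measurable_geomean; [case: h0|case: h1].
  by apply: aeW => x; rewrite ger0_norm ?geomean_ge0.
have : {ae nu, forall y (q : rat), 0 < ratr q :> R ->
    Top (fun x => geomean t (f0 x) (f1 x)) y <=
    ratr q `^ t * Top f0 y + ratr q `^ (t - 1) * Top f1 y}.
  apply: ae_forall_rat => q; have [q0|q0] := ltP 0 (ratr q : R); last first.
    by apply: aeW.
  have sl := inSum_lin bX0 bX1 (ratr q `^ t) (ratr q `^ (t - 1)) s0 s1.
  have : {ae nu, forall y, Top (fun x => geomean t (f0 x) (f1 x)) y <=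
      Top (fun x => ratr q `^ t * f0 x + ratr q `^ (t - 1) * f1 x) y}.
    by apply: op_le => //; apply: aeW => x; exact: geomean_scale_le.
  case: lin => _ _ /(_ (ratr q `^ t) (ratr q `^ (t - 1)) f0 f1 s0 s1).
  by apply: filterS2 => y ->.
by apply: filterS3 (op_ge0 s0 p0) (op_ge0 s1 p1) => y h0' h1';
  exact: geomean_inf.
Qed.

Context (bY0 : banach_lattice nu Y0) (bY1 : banach_lattice nu Y1).
Context (bd0 : bounded_op X0 Y0 Top) (bd1 : bounded_op X1 Y1 Top).

(** The images of the factors majorising [f] are factors for [Top f]; each absorbs the 3 of
    [op_geomean]. *)
Lemma op_calderon f : inX (calderon mu X0 X1 t) f ->
  inX (calderon nu Y0 Y1 t) (Top f).
Proof.
move=> [mf hf]; have sf := calderon_inSum bX0 bX1 t01 mf hf.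
move: hf => /(calderon_ltyP bX0 bX1)[f0 [f1 [h0 h1 p0 p1 h]]].
split; first exact: op_measurable.
have s0 := inSum0 bX0 bX1 h0; have s1 := inSum1 bX0 bX1 h1.
have sg : inS (fun x => geomean t (f0 x) (f1 x)).
  apply: (inSum_geomean_le bX0 bX1 t01 _ h0 h1) => //.
    by apply: measurable_geomean; [case: h0|case: h1].
  by apply: aeW => x; rewrite ger0_norm ?geomean_ge0.
apply/(calderon_ltyP bY0 bY1).
exists (fun y => 3 * `|Top f0 y|), (fun y => 3 * `|Top f1 y|); split.
- apply: (inXZ bY0); apply: (inX_norm bY0).
  by case: bd0 => C /(_ _ h0)[].
- apply: (inXZ bY1); apply: (inX_norm bY1).
  by case: bd1 => C /(_ _ h1)[].
- by move=> y; rewrite mulr_ge0.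
- by move=> y; rewrite mulr_ge0.
have h2 : {ae nu, forall y, Top (fun x => `|f x|) y <=
    Top (fun x => geomean t (f0 x) (f1 x)) y}.
  by apply: op_le => //; exact: inSum_norm.
have h3 : {ae nu, forall y, 0 <= Top f0 y /\ 0 <= Top f1 y}.
  by apply: filterS2 (op_ge0 s0 p0) (op_ge0 s1 p1) => y.
apply: filter_app (op_norm sf); apply: filter_app (op_geomean h0 h1 p0 p1).
apply: filterS2 h2 h3 => y h2 [q0 q1] h4 h5.
by rewrite geomeanZ// (ger0_norm q0) (ger0_norm q1); lra.
Qed.

End PositiveOperator.

(** * The K-functional and finiteness of the real interpolation norm *)

Section KFunctional.
Context {R : realType} d (T : measurableType d) (mu : {measure set T -> \bar R}).
Context (X0 X1 : (T -> R) -> \bar R).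
Context (bl0 : banach_lattice mu X0) (bl1 : banach_lattice mu X1).
Implicit Types f g : T -> R.

Lemma Kfun_ge0 t f : 0 <= t -> (0 <= Kfun mu X0 X1 t f)%E.
Proof.
move=> t0; apply: le_ereal_inf_tmp => _ [[p0 p1] /= [[m0 _] [m1 _] _] <-].
apply: adde_ge0; first exact: (lnorm_ge0 bl0).
by apply: mule_ge0; [rewrite lee_fin|exact: (lnorm_ge0 bl1)].
Qed.

Lemma Kfun_fin t f : 0 <= t -> inSum mu X0 X1 f ->
  Kfun mu X0 X1 t f \is a fin_num.
Proof.
move=> t0 [mf [p0 [p1 [h0 h1 h]]]]; rewrite ge0_fin_numE ?Kfun_ge0//.
apply: (@le_lt_trans _ _ (X0 p0 + t%:E * X1 p1)%E).
  by apply: ereal_inf_lbound; exists (p0, p1).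
by rewrite -(fineK (inX_fin bl0 h0)) -(fineK (inX_fin bl1 h1)) ltry.
Qed.

Lemma Kfun_nd s t f : s <= t -> (Kfun mu X0 X1 s f <= Kfun mu X0 X1 t f)%E.
Proof.
move=> st; apply: le_ereal_inf_tmp => _ [[p0 p1] /= [h0 h1 h] <-].
apply: ge_ereal_inf; exists (X0 p0 + s%:E * X1 p1)%E; first by exists (p0, p1).
apply: leeD => //; apply: lee_wpmul2r; last by rewrite lee_fin.
by apply: (lnorm_ge0 bl1); case: h1.
Qed.

Lemma Kfun_notin t f : measurable_fun setT f -> ~ inSum mu X0 X1 f ->
  Kfun mu X0 X1 t f = +oo%E.
Proof.
move=> mf nf; apply/ereal_inf_pinfty => z [[p0 p1] /= [h0 h1 h] _].
by exfalso; apply: nf; split=> //; exists p0, p1.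
Qed.

(* The truncation at 0 makes the K-functional monotone, hence measurable, on the whole line. *)
Definition Kweight (theta r : R) f (t : R) : R :=
  (t `^ (- theta) * fine (Kfun mu X0 X1 (Num.max t 0) f)) `^ r * t `^ (- 1).

Lemma Kweight_ge0 theta r f t : 0 <= Kweight theta r f t.
Proof. by rewrite mulr_ge0 ?powR_ge0. Qed.

Lemma measurable_Kweight theta r f : inSum mu X0 X1 f ->
  measurable_fun setT (Kweight theta r f).
Proof.
move=> sf; apply: measurable_mulf; last exact: measurable_powR.
apply: measurable_powRf; apply: measurable_mulf; first exact: measurable_powR.
apply: nondecreasing_measurable => // s t st; apply: fine_le.
- by apply: Kfun_fin; rewrite // le_max lexx orbT.
- by apply: Kfun_fin; rewrite // le_max lexx orbT.
- by apply: Kfun_nd; rewrite ge_max !le_max st lexx !orbT.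
Qed.

(** The outer power [r^-1] does not affect finiteness, and on the sum the K-functional is finite, so
    a real-valued measurable integrand can replace the extended one. *)
Lemma realint_lty theta (r : R) f : 1 <= r -> inSum mu X0 X1 f ->
  (realint mu X0 X1 theta r%:E f < +oo)%E <->
  (\int[@lebesgue_measure R]_(t in posR) (Kweight theta r f t)%:E < +oo)%E.
Proof.
move=> r1 sf; rewrite /realint.
rewrite [X in poweR X](_ : _ =
    \int[@lebesgue_measure R]_(t in posR) (Kweight theta r f t)%:E)%E; last first.
  apply: eq_integral => t; rewrite inE /posR/= in_itv/= andbT => t0.
  rewrite /Kweight (max_idPl (ltW t0)) powR_inv1 ?(ltW t0)//.
  by rewrite -{1}(fineK (Kfun_fin (ltW t0) sf)).
split=> [|h]; last exact: poweR_lty.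
by apply: lty_poweRy; rewrite invr_neq0// gt_eqF//; lra.
Qed.

(** Off the sum the K-functional is the infimum of an empty set, so the integrand is [+oo] on the
    whole half-line. *)
Lemma realint_inSum theta p f : (1 <= p)%E -> measurable_fun setT f ->
  (realint mu X0 X1 theta p f < +oo)%E -> inSum mu X0 X1 f.
Proof.
move=> p1 mf h; apply: contrapT => nf; move: h.
have Ky t : 0 < t ->
    ((t `^ (- theta)%R)%:E * Kfun mu X0 X1 t f)%E = +oo%E.
  by move=> t0; rewrite Kfun_notin// mulry gtr0_sg ?mul1e ?powR_gt0.
case: p p1 => [r| |]//= r1.
  have r0 : r != 0 by apply: lt0r_neq0; move: r1; rewrite lee_fin; lra.
  rewrite [X in poweR X](_ : _ =
      \int[@lebesgue_measure R]_(t in posR) (cst +oo t))%E; last first.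
    apply: eq_integral => t; rewrite inE /posR/= in_itv/= andbT => t0.
    rewrite Ky// poweRyr//.
    by rewrite mulyr gtr0_sg ?mul1e// invr_gt0.
  have lpos : lebesgue_measure (posR : set R) = +oo%E.
    by rewrite /posR lebesgue_measure_itv/= ltry.
  have mpos : measurable (posR : set R) by exact: measurable_itv.
  have -> : (\int[@lebesgue_measure R]_(t in posR) (cst +oo t) = +oo)%E.
    by rewrite integral_cst// [X in (_ * X)%E]lpos mulyy.
  by rewrite poweRyr// invr_neq0.
rewrite ereal_supy//; exists 1; last exact: Ky.
by rewrite /posR/= in_itv/= ltr01.
Qed.

End KFunctional.

(** * Real interpolation of operators bounded at both endpoints *)

Section OperatorInterpolation.
Context {R : realType} d1 d2 (S1 : measurableType d1) (S2 : measurableType d2).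
Context (mu : {measure set S1 -> \bar R}) (nu : {measure set S2 -> \bar R}).
Context (X0 X1 : (S1 -> R) -> \bar R) (Y0 Y1 : (S2 -> R) -> \bar R).
Context (Top : (S1 -> R) -> (S2 -> R)).
Context (bX0 : banach_lattice mu X0) (bX1 : banach_lattice mu X1).
Context (bY0 : banach_lattice nu Y0) (bY1 : banach_lattice nu Y1).
Context (lin : linear_op mu nu X0 X1 Y0 Y1 Top).
Context (bd0 : bounded_op X0 Y0 Top) (bd1 : bounded_op X1 Y1 Top).

(** Every decomposition of [f] is mapped to a decomposition of [Top f]. The summand 1 in [C] makes
    it positive, so that it can be divided out under the infimum. *)
Lemma op_Kfun : exists2 C : R, 0 < C & forall t f, 0 < t -> inSum mu X0 X1 f ->
  (Kfun nu Y0 Y1 t (Top f) <= C%:E * Kfun mu X0 X1 t f)%E.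
Proof.
case: bd0 => C0 h0; case: bd1 => C1 h1; pose C := 1 + `|C0| + `|C1|.
have C_gt0 : 0 < C by rewrite /C; have := normr_ge0 C0; have := normr_ge0 C1; lra.
have C0C : C0 <= C.
  by rewrite /C; have := ler_norm C0; have := normr_ge0 C1; lra.
have C1C : C1 <= C.
  by rewrite /C; have := ler_norm C1; have := normr_ge0 C0; lra.
exists C => // t f t0 sf; rewrite -lee_pdivrMl//.
apply: le_ereal_inf_tmp => _ [[p0 p1] /= [q0 q1 h] <-].
rewrite lee_pdivrMl//; have [v0 b0] := h0 _ q0; have [v1 b1] := h1 _ q1.
have m0 : (0 <= X0 p0)%E by apply: (lnorm_ge0 bX0); case: q0.
have m1 : (0 <= X1 p1)%E by apply: (lnorm_ge0 bX1); case: q1.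
apply: (@le_trans _ _ (Y0 (Top p0) + t%:E * Y1 (Top p1))%E).
  apply: ereal_inf_lbound; exists (Top p0, Top p1) => //; split => //=.
  have s0 := inSum0 bX0 bX1 q0; have s1 := inSum1 bX0 bX1 q1.
  have := op_ae_eq lin sf (inSumD bX0 bX1 s0 s1) h.
  by apply: filterS2 (opD lin s0 s1) => y ->.
move: (inX_fin bX0 q0) (inX_fin bX1 q1) (inX_fin bY0 v0) (inX_fin bY1 v1) m0 m1 b0 b1.
case: (X0 p0) => // x0; case: (X1 p1) => // x1; case: (Y0 (Top p0)) => // y0.
case: (Y1 (Top p1)) => // y1 _ _ _ _.
rewrite -!EFinM -!EFinD !lee_fin => x0_ge0 x1_ge0 b0 b1.
rewrite mulrDr mulrCA; apply: lerD.
  by apply: le_trans b0 _; exact: ler_wpM2r.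
apply: ler_wpM2l; first exact: ltW.
by apply: le_trans b1 _; exact: ler_wpM2r.
Qed.

Lemma op_realint theta p f : (1 <= p)%E -> inX (realint mu X0 X1 theta p) f ->
  inX (realint nu Y0 Y1 theta p) (Top f).
Proof.
move=> p1 [mf hf]; have sf := realint_inSum p1 mf hf.
have sTf := op_inSum lin sf; split; first exact: (op_measurable lin sf).
have [C C0 HC] := op_Kfun.
case: p p1 hf => [r| |]//; last first.
  move=> _ /= hf; apply: (@le_lt_trans _ _ (C%:E *
     ereal_sup [set ((t `^ (- theta)%R)%:E * Kfun mu X0 X1 t f)%E | t in posR])%E).
    apply: ge_ereal_sup => _ [t /= t0 <-].
    have t_gt0 : 0 < t by move: t0; rewrite /posR/= in_itv/= andbT.
    apply: (@le_trans _ _ (C%:E * ((t `^ (- theta)%R)%:E * Kfun mu X0 X1 t f))%E).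
      rewrite muleCA; apply: lee_wpmul2l; first by rewrite lee_fin powR_ge0.
      exact: HC.
    apply: lee_wpmul2l; first by rewrite lee_fin ltW.
    by apply: ereal_sup_ubound; exists t.
  by apply: lte_mul_pinfty => //; rewrite lee_fin ltW.
rewrite lee_fin => r1.
move=> /(realint_lty bX0 bX1 theta r1 sf) hf.
apply/(realint_lty bY0 bY1 theta r1 sTf).
have mpos : measurable (posR : set R) by exact: measurable_itv.
apply: (@le_lt_trans _ _ (\int[@lebesgue_measure R]_(t in posR)
    ((C `^ r)%:E * (Kweight mu X0 X1 theta r f t)%:E))%E).
  apply: ge0_le_integral => //.
  - by move=> t _; rewrite lee_fin Kweight_ge0.
  - apply/measurable_EFinP; apply: measurable_funTS.
    exact: (measurable_Kweight bY0 bY1).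
  - apply/measurable_EFinP; apply: measurable_funTS; apply: measurable_scalef.
    exact: (measurable_Kweight bX0 bX1).
  move=> t; rewrite /posR/= in_itv/= andbT => t0.
  have t0' := ltW t0.
  have kX : 0 <= fine (Kfun mu X0 X1 t f) by rewrite fine_ge0// Kfun_ge0.
  have kY : 0 <= fine (Kfun nu Y0 Y1 t (Top f)) by rewrite fine_ge0// Kfun_ge0.
  rewrite -EFinM lee_fin /Kweight (max_idPl t0') mulrA -powRM//; last 2 first.
  - exact: ltW.
  - by rewrite mulr_ge0 ?powR_ge0.
  apply: ler_wpM2r; first exact: powR_ge0.
  apply: ge0_ler_powR; first lra.
  - by rewrite nnegrE mulr_ge0 ?powR_ge0.
  - by rewrite nnegrE !mulr_ge0 ?powR_ge0// ltW.
  rewrite mulrCA; apply: ler_wpM2l; first exact: powR_ge0.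
  rewrite -lee_fin EFinM !fineK; first exact: HC.
    exact: Kfun_fin.
  exact: Kfun_fin.
rewrite ge0_integralZl_EFin//.
- by apply: lte_mul_pinfty => //; rewrite lee_fin powR_ge0.
- by move=> t _; rewrite lee_fin Kweight_ge0.
- apply/measurable_EFinP; apply: measurable_funTS.
  exact: (measurable_Kweight bX0 bX1).
- exact: powR_ge0.
Qed.

End OperatorInterpolation.

(** * Order continuity of the operator *)

Lemma cvg_min_mul (R : realType) (a b : R) : 0 < b ->
  (fun m => Num.min a (m%:R * b)) @ \oo --> a.
Proof.
move=> b0; apply: cvg_near_cst; exists (Num.truncn (a / b)).+1 => // m /= hm.
apply/min_idPl; rewrite -ler_pdivrMr//; apply/ltW/(lt_le_trans (truncnS_gt _)).
by rewrite ler_nat.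
Qed.

(** Regularity sends the norms of [a n] to 0, boundedness transfers this to [Top (a n)], and
    [ae_small] makes it pointwise. *)
Lemma regular_op_small (R : realType) d1 d2 (S1 : measurableType d1)
    (S2 : measurableType d2) (mu : {measure set S1 -> \bar R})
    (nu : {measure set S2 -> \bar R}) (X : (S1 -> R) -> \bar R)
    (Y : (S2 -> R) -> \bar R) (Top : (S1 -> R) -> (S2 -> R))
    (a : nat -> S1 -> R) :
  banach_lattice mu X -> banach_lattice nu Y -> regular mu X ->
  bounded_op X Y Top -> (forall n, inX X (a n)) ->
  {ae mu, forall x, forall n, 0 <= a n.+1 x /\ a n.+1 x <= a n x} ->
  {ae mu, forall x, a ^~ x @ \oo --> 0} ->
  {ae nu, forall y (e : R), 0 < e -> exists n, Top (a n) y <= e}.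
Proof.
move=> bX bY reg [C bd] aX a_dec a_cv; apply: (ae_small bY) => [n|e e0].
  by have [[]] := bd _ (aX n).
have [_ /cvgrPdist_lt] : (\forall n \near \oo, X (a n) \is a fin_num) /\
    (fine \o (X \o a)) @ \oo --> (0 : R).
  by apply/fine_cvgP; exact: reg.
have C1 : 0 < `|C| + 1 by rewrite ltr_wpDl.
move=> /(_ (e / (`|C| + 1)))[]; first by rewrite divr_gt0.
move=> n _ /(_ n (leqnn _)) /=; rewrite sub0r normrN => h.
exists n; have [_ /le_trans] := bd _ (aX n); apply.
have X0 : 0 <= fine (X (a n)) by rewrite fine_ge0// (lnorm_ge0 bX); case: (aX n).
rewrite -(fineK (inX_fin bX (aX n))) -EFinM lee_fin.
apply: (@le_trans _ _ ((`|C| + 1) * fine (X (a n)))).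
  by apply: ler_wpM2r => //; apply: ler_wpDr => //; exact: ler_norm.
by rewrite -ler_pdivlMl// mulrC ltW//; apply: le_lt_trans h; exact: ler_norm.
Qed.

Section OrderContinuity.
Context {R : realType} d1 d2 (S1 : measurableType d1) (S2 : measurableType d2).
Context (mu : {measure set S1 -> \bar R}) (nu : {measure set S2 -> \bar R}).
Context (X0 X1 : (S1 -> R) -> \bar R) (Y0 Y1 : (S2 -> R) -> \bar R).
Context (Top : (S1 -> R) -> (S2 -> R)).
Context (bX0 : banach_lattice mu X0) (bX1 : banach_lattice mu X1).
Context (bY0 : banach_lattice nu Y0) (bY1 : banach_lattice nu Y1).
Context (rX0 : regular mu X0) (rX1 : regular mu X1).
Context (lin : linear_op mu nu X0 X1 Y0 Y1 Top).
Context (pos : positive_op mu nu X0 X1 Top).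
Context (bd0 : bounded_op X0 Y0 Top) (bd1 : bounded_op X1 Y1 Top).

Local Notation inS := (inSum mu X0 X1).

(* [H - h n] is split into a part below |p0| and a part below |p1|, where
   [H = p0 + p1], so that regularity applies to each of the two parts. *)
Lemma op_order_continuous (h : nat -> S1 -> R) (H : S1 -> R) (g : S2 -> R) :
  inS H -> (forall n, measurable_fun setT (h n)) ->
  {ae mu, forall x n, [/\ 0 <= h n x, h n x <= h n.+1 x & h n x <= H x]} ->
  {ae mu, forall x, h ^~ x @ \oo --> H x} ->
  (forall n, {ae nu, forall y, Top (h n) y <= g y}) ->
  {ae nu, forall y, Top H y <= g y}.
Proof.
move=> sH mh h_nd h_cv hg; have mH : measurable_fun setT H by case: sH.
have [_ [p0 [p1 [q0 q1 Hp]]]] := sH.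
have mp0 : measurable_fun setT (fun x => `|p0 x|).
  by apply: measurable_normf; case: q0.
pose k n x := H x - h n x.
pose al n x := Num.min (k n x) `|p0 x|.
pose be n x := Num.max (k n x - `|p0 x|) 0.
have mk n : measurable_fun setT (k n) by exact: measurable_subf.
have alX n : inX X0 (al n).
  apply: (inX_le bX0 q0); first exact: measurable_minf.
  apply: filterS h_nd => x /(_ n)[_ _ hH]; rewrite ger0_norm.
    by rewrite ge_min lexx orbT.
  by rewrite le_min normr_ge0 andbT subr_ge0.
have beX n : inX X1 (be n).
  apply: (inX_le bX1 q1).
    by apply: measurable_maxf => //; exact: measurable_subf.
  apply: filterS2 h_nd Hp => x /(_ n)[h0 _ hH] Hx.
  rewrite ger0_norm; last by rewrite le_max lexx orbT.
  rewrite ge_max normr_ge0 andbT /k Hx.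
  by have := ler_norm (p0 x); have := ler_norm (p1 x); lra.
have k_cv : {ae mu, forall x, k ^~ x @ \oo --> 0}.
  apply: filterS h_cv => x hx; rewrite -(subrr (H x)).
  by apply: cvgB => //; exact: cvg_cst.
have al_dec : {ae mu, forall x, forall n, 0 <= al n.+1 x /\ al n.+1 x <= al n x}.
  apply: filterS h_nd => x hx n; have [_ _ h1] := hx n.+1; have [_ h2 _] := hx n.
  split; first by rewrite le_min normr_ge0 andbT subr_ge0.
  by rewrite le_min !ge_min lexx orbT andbT /k lerB.
have be_dec : {ae mu, forall x, forall n, 0 <= be n.+1 x /\ be n.+1 x <= be n x}.
  apply: filterS h_nd => x hx n; have [_ _ h1] := hx n.+1; have [_ h2 _] := hx n.
  split; first by rewrite le_max lexx orbT.
  by rewrite ge_max !le_max lexx orbT andbT /k !lerB.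
have al_cv : {ae mu, forall x, al ^~ x @ \oo --> 0}.
  apply: filterS2 h_nd k_cv => x hx kx.
  apply: (@squeeze_cvgr _ _ _ _ (fun=> 0) (k ^~ x)); last 2 first.
  - exact: cvg_cst.
  - exact: kx.
  apply: nearW => n; have [_ _ hH] := hx n.
  by rewrite ge_min lexx andbT le_min normr_ge0 andbT subr_ge0.
have be_cv : {ae mu, forall x, be ^~ x @ \oo --> 0}.
  apply: filterS2 h_nd k_cv => x hx kx.
  apply: (@squeeze_cvgr _ _ _ _ (fun=> 0) (k ^~ x)); last 2 first.
  - exact: cvg_cst.
  - exact: kx.
  apply: nearW => n; have [_ _ hH] := hx n.
  rewrite le_max lexx orbT ge_max /k subr_ge0 hH andbT.
  by have := normr_ge0 (p0 x); lra.
have al_s := regular_op_small bX0 bY0 rX0 bd0 alX al_dec al_cv.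
have be_s := regular_op_small bX1 bY1 rX1 bd1 beX be_dec be_cv.
have sal n := inSum0 bX0 bX1 (alX n).
have sbe n := inSum1 bX0 bX1 (beX n).
have sh n : inS (h n).
  apply: (inSum_le bX0 bX1 sH (mh n)).
  by apply: filterS h_nd => x /(_ n)[h0 _ hH]; rewrite !ger0_norm// (le_trans h0).
have al_nd : {ae nu, forall y n, Top (al n.+1) y <= Top (al n) y}.
  apply: ae_foralln => n; apply: (op_le bX0 bX1 lin pos) => //.
  by apply: filterS al_dec => x /(_ n)[].
have be_nd : {ae nu, forall y n, Top (be n.+1) y <= Top (be n) y}.
  apply: ae_foralln => n; apply: (op_le bX0 bX1 lin pos) => //.
  by apply: filterS be_dec => x /(_ n)[].
have HE : {ae nu, forall y n, Top H y <= g y + Top (al n) y + Top (be n) y}.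
  apply: ae_foralln => n.
  have E : (fun x => H x - h n x) = (fun x => al n x + be n x).
    apply/funext => x; rewrite /al /be /k /Num.min /Num.max.
    by case: ifPn; case: ifPn; rewrite -?leNgt; lra.
  have := opB lin sH (sh n); rewrite E => e1.
  apply: filterS3 e1 (opD lin (sal n) (sbe n)) (hg n) => y -> e2 e3.
  lra.
apply: filter_app al_s; apply: filter_app be_s.
apply: filterS3 al_nd be_nd HE => y and_ bnd HEy sb sa.
have mono (u : nat -> R) n m : (forall i, u i.+1 <= u i) -> (n <= m)%N -> u m <= u n.
  move=> hu; elim: m => [|m IH]; first by rewrite leqn0 => /eqP ->.
  rewrite leq_eqVlt ltnS => /predU1P[->//|/IH]; exact/le_trans/hu.
apply/ler_addgt0Pr => e e0.
(* Each part is small at one index only; both sequences decrease at [y], so the larger index serves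
   for both. *)
have [n1 h1] := sa (e / 2) ltac:(lra); have [n2 h2] := sb (e / 2) ltac:(lra).
have := HEy (maxn n1 n2).
have := mono (fun n => Top (al n) y) _ _ and_ (leq_maxl n1 n2).
have := mono (fun n => Top (be n) y) _ _ bnd (leq_maxr n1 n2).
rewrite /=; lra.
Qed.

End OrderContinuity.

(** * From the Calderon product to the whole sum: bipositivity and the range *)

Section OrderIsomorphism.
Context {R : realType} d1 d2 (S1 : measurableType d1) (S2 : measurableType d2).
Context (mu : {measure set S1 -> \bar R}) (nu : {measure set S2 -> \bar R}).
Context (X0 X1 : (S1 -> R) -> \bar R) (Y0 Y1 : (S2 -> R) -> \bar R).
Context (Top : (S1 -> R) -> (S2 -> R)).
Context (bX0 : banach_lattice mu X0) (bX1 : banach_lattice mu X1).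
Context (bY0 : banach_lattice nu Y0) (bY1 : banach_lattice nu Y1).
Context (rX0 : regular mu X0) (rX1 : regular mu X1).
Context (lin : linear_op mu nu X0 X1 Y0 Y1 Top).
Context (pos : positive_op mu nu X0 X1 Top).
Context (bd0 : bounded_op X0 Y0 Top) (bd1 : bounded_op X1 Y1 Top).
Context (s : R) (s01 : 0 < s < 1).

Local Notation inS := (inSum mu X0 X1).
Local Notation XC := (calderon mu X0 X1 s).
Local Notation YC := (calderon nu Y0 Y1 s).

Context (iso : order_iso mu nu XC YC Top).

Let XC_inS f : inX XC f -> inS f.
Proof. by move=> [mf hf]; exact: (calderon_inSum bX0 bX1 s01). Qed.

Let XC0 : inX XC (fun=> 0).
Proof.
have [w [wX _ _]] := calderon_unit bX0 bX1 s.
apply: (calderon_le bX0 bX1 _ _ wX); first exact: measurable_cst.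
by apply: aeW => x; rewrite normr0.
Qed.

Let XCZ c f : inX XC f -> inX XC (fun x => c * f x).
Proof.
move=> hf; have := calderon_lin bX0 bX1 s01 c 0 hf hf.
by congr inX; apply/funext => x; ring.
Qed.

Lemma op0 : {ae nu, forall y, Top (fun=> 0) y = 0}.
Proof.
have := opZ lin 0 (XC_inS XC0).
under [X in Top X]eq_fun do rewrite mul0r.
by apply: filterS => y ->; rewrite mul0r.
Qed.

(** The minimum of the images lies in the target product by solidity, so it is the image of some
    [x]. Positivity of the inverse gives [0 <= x <= p] and [x <= e], hence [x = 0]. *)
Lemma op_disjoint p e : inX XC p -> inX XC e ->
  {ae mu, forall x, [/\ 0 <= p x, 0 <= e x & Num.min (p x) (e x) <= 0]} ->
  {ae nu, forall y, Num.min (Top p y) (Top e y) <= 0}.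
Proof.
move=> hp he pe; case: iso => i1 i2 i3 i4 i5.
have p0 : {ae mu, forall x, 0 <= p x} by apply: filterS pe => x [].
have e0 : {ae mu, forall x, 0 <= e x} by apply: filterS pe => x [].
have [mp hTp] := i1 _ hp; have [me hTe] := i1 _ he.
pose y z := Num.min (Top p z) (Top e z).
have my : measurable_fun setT y by exact: measurable_minf.
have y0 : {ae nu, forall z, 0 <= y z}.
  by apply: filterS2 (i4 _ hp p0) (i4 _ he e0) => z h1 h2; rewrite le_min h1.
have yC : inX YC y.
  apply: (calderon_le bY0 bY1 my _ (i1 _ hp)).
  apply: filterS2 y0 (i4 _ hp p0) => z h1 h2; rewrite !ger0_norm//.
  by rewrite ge_min lexx.
have [x [hx Tx]] := i3 _ yC.
have below q : inX XC q -> {ae nu, forall z, y z <= Top q z} ->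
    {ae mu, forall u, x u <= q u}.
  move=> hq yq; have hB : inX XC (fun u => 1 * q u + -1 * x u).
    exact: (calderon_lin bX0 bX1 s01).
  have : {ae mu, forall u, 0 <= 1 * q u + -1 * x u}.
    apply: i5 => //; case: lin => _ _ /(_ 1 (-1) q x (XC_inS hq) (XC_inS hx)).
    by apply: filterS3 Tx yq => z -> h ->; lra.
  by apply: filterS => u; lra.
have xp : {ae mu, forall u, x u <= p u}.
  by apply: below => //; apply: aeW => z; rewrite ge_min lexx.
have xe : {ae mu, forall u, x u <= e u}.
  by apply: below => //; apply: aeW => z; rewrite ge_min lexx orbT.
have x0 : {ae mu, forall u, 0 <= x u}.
  by apply: i5 => //; apply: filterS2 Tx y0 => z ->.
have xE : {ae mu, forall u, x u = 0}.
  apply: filter_app x0; apply: filterS3 xp xe pe => u h1 h2 [_ _ h3] h4.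
  have : x u <= Num.min (p u) (e u) by rewrite le_min h1.
  by lra.
have := op_ae_eq lin (XC_inS hx) (XC_inS XC0) xE.
by apply: filterS3 op0 Tx => z -> + <-; rewrite /y => ->.
Qed.

(** The truncations at multiples of a weak unit lie in the Calderon product, where [iso] can be
    used, and increase to [f]; order continuity then reaches [f] itself. *)
Let min_mul_order_continuous w f g : inX XC w -> (forall x, 0 <= w x) ->
  {ae mu, forall x, 0 < w x} -> inS f -> {ae mu, forall x, 0 <= f x} ->
  (forall m : nat, {ae nu, forall y,
     Top (fun x => Num.min (f x) (m%:R * w x)) y <= g y}) ->
  {ae nu, forall y, Top f y <= g y}.
Proof.
move=> wX w0 wp sf f0 hg; have mf : measurable_fun setT f by case: sf.
have mw : measurable_fun setT w by case: wX.
apply: (op_order_continuous bX0 bX1 bY0 bY1 rX0 rX1 lin pos bd0 bd1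
  (h := fun m x => Num.min (f x) (m%:R * w x)) sf) => //.
- by move=> m; apply: measurable_minf => //; exact: measurable_scalef.
- apply: filterS f0 => x fx m; split.
  + by rewrite le_min fx mulr_ge0.
  + by rewrite le_min !ge_min lexx/= ler_wpM2r ?ler_nat ?orbT.
  + by rewrite ge_min lexx.
- by apply: filterS wp => x; exact: cvg_min_mul.
Qed.

(** [e], the truncated negative part, is disjoint from every truncation of [fp], so [Top fp <= 0]
    where [Top e > 0]. But [Top fp >= Top fn >= Top e], so [Top e = 0]; injectivity on the Calderon
    product gives [e = 0], hence [fn = 0]. *)
Lemma op_ge0_inv f : inS f -> {ae nu, forall y, 0 <= Top f y} ->
  {ae mu, forall x, 0 <= f x}.
Proof.
move=> sf Tf0; case: iso => i1 i2 i3 i4 i5.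
have [w [wX w0 wp]] := calderon_unit bX0 bX1 s.
have mw : measurable_fun setT w by case: wX.
have mf : measurable_fun setT f by case: sf.
pose fp x := Num.max (f x) 0; pose fn x := Num.max (- f x) 0.
have mfp : measurable_fun setT fp by exact: measurable_maxf.
have mfn : measurable_fun setT fn.
  by apply: measurable_maxf => //; exact: measurable_oppf.
have fp0 x : 0 <= fp x by rewrite le_max lexx orbT.
have fn0 x : 0 <= fn x by rewrite le_max lexx orbT.
have fE x : f x = fp x - fn x.
  by rewrite /fp /fn /Num.max; case: ifPn; case: ifPn; rewrite -?leNgt; lra.
have pn x : fp x = 0 \/ fn x = 0.
  have [h|h] : 0 <= f x \/ f x < 0 by case: (leP 0 (f x)); [left|right].
    by right; rewrite /fn /Num.max; case: ifPn; rewrite -?leNgt; lra.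
  by left; rewrite /fp /Num.max; case: ifPn; rewrite -?leNgt; lra.
have sfp : inS fp.
  apply: (inSum_le bX0 bX1 sf) => //; apply: aeW => x; rewrite (ger0_norm (fp0 x)).
  by rewrite ge_max ler_norm normr_ge0.
have sfn : inS fn.
  apply: (inSum_le bX0 bX1 sf) => //; apply: aeW => x; rewrite (ger0_norm (fn0 x)).
  by rewrite ge_max normr_ge0 -normrN ler_norm.
pose e x := Num.min (fn x) (w x).
have e0 x : 0 <= e x by rewrite le_min fn0 w0.
have me : measurable_fun setT e by exact: measurable_minf.
have eX : inX XC e.
  apply: (calderon_le bX0 bX1 me _ wX); apply: aeW => x.
  by rewrite !ger0_norm// ge_min lexx orbT.
have efn : {ae nu, forall y, Top e y <= Top fn y}.
  apply: (op_le bX0 bX1 lin pos) => //; first exact: XC_inS.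
  by apply: aeW => x; rewrite ge_min lexx.
have fpg : {ae nu, forall y, Top fp y <= if 0 < Top e y then 0 else Top fp y}.
  apply: (min_mul_order_continuous wX) => // [|m]; first exact: aeW.
  pose p x := Num.min (fp x) (m%:R * w x).
  have p0 x : 0 <= p x by rewrite le_min fp0 mulr_ge0.
  have mp : measurable_fun setT p.
    by apply: measurable_minf => //; exact: measurable_scalef.
  have pX : inX XC p.
    apply: (calderon_le bX0 bX1 mp _ (XCZ m%:R wX)); apply: aeW => x.
    by rewrite !ger0_norm ?mulr_ge0// ge_min lexx orbT.
  have pfp : {ae nu, forall y, Top p y <= Top fp y}.
    apply: (op_le bX0 bX1 lin pos) => //; first exact: XC_inS.
    by apply: aeW => x; rewrite ge_min lexx.
  have dis : {ae nu, forall y, Num.min (Top p y) (Top e y) <= 0}.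
    apply: op_disjoint => //; apply: aeW => x; split=> //.
    by case: (pn x) => E; rewrite ge_min /p /e E !ge_min lexx ?orbT.
  apply: filterS2 pfp dis => y h1; case: ifPn => // h2.
  by rewrite ge_min => /orP[//|h3]; move: h2; rewrite ltNge h3.
have Te : {ae nu, forall y, Top e y = Top (fun=> 0) y}.
  have fD := opB lin sfp sfn.
  have e1 : (fun x => fp x - fn x) = f by apply/funext => x; rewrite fE.
  rewrite e1 in fD; have Te0 := i4 _ eX (aeW _ e0).
  apply: filter_app op0; apply: filter_app Te0; apply: filter_app efn.
  apply: filterS3 Tf0 fD fpg => y h1 h2 h3 h4 h5 ->.
  by move: h3; case: ifPn => [h6|]; rewrite -?leNgt; lra.
have := i2 _ _ eX XC0 Te; apply: filterS2 wp => x wx.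
rewrite /e fE /Num.min; case: ifPn => [_ ->|_ h]; first by rewrite subr0.
by move: wx; rewrite h ltxx.
Qed.

Lemma op_le_inv f g : inS f -> inS g -> {ae nu, forall y, Top f y <= Top g y} ->
  {ae mu, forall x, f x <= g x}.
Proof.
move=> sf sg fg; have : {ae mu, forall x, 0 <= g x - f x}.
  apply: op_ge0_inv; first exact: inSumB.
  by apply: filterS2 fg (opB lin sg sf) => y h ->; rewrite subr_ge0.
by apply: filterS => x; rewrite subr_ge0.
Qed.

Lemma op_eq_inv f g : inS f -> inS g -> {ae nu, forall y, Top f y = Top g y} ->
  {ae mu, forall x, f x = g x}.
Proof.
move=> sf sg fg.
have h1 : {ae mu, forall x, f x <= g x}.
  by apply: op_le_inv => //; apply: filterS fg => y ->.
have h2 : {ae mu, forall x, g x <= f x}.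
  by apply: op_le_inv => //; apply: filterS fg => y ->.
by apply: filterS2 h1 h2 => x ? ?; apply/eqP; rewrite eq_le; apply/andP.
Qed.

(** Let [x] be the preimage of a weak unit [W]. Where [Top w <= 0], the truncations of [x] at
    [m * w] have nonpositive image, and in the limit [W <= 0]; such points form a null set. *)
Lemma op_unit_gt0 w : inX XC w -> (forall x, 0 <= w x) ->
  {ae mu, forall x, 0 < w x} -> {ae nu, forall y, 0 < Top w y}.
Proof.
move=> wX w0 wp; case: iso => i1 i2 i3 i4 i5.
have mw : measurable_fun setT w by case: wX.
have [W [WX W0 Wp]] := calderon_unit bY0 bY1 s.
have [x [xX Tx]] := i3 _ WX; have sx := XC_inS xX.
have mx : measurable_fun setT x by case: xX.
have x0 : {ae mu, forall u, 0 <= x u}.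
  by apply: i5 => //; apply: filterS Tx => y ->.
have : {ae nu, forall y, Top x y <= if 0 < Top w y then W y else 0}.
  apply: (min_mul_order_continuous wX) => // m.
  have sm : inS (fun u => Num.min (x u) (m%:R * w u)).
    apply: (inSum_le bX0 bX1 sx).
      by apply: measurable_minf => //; exact: measurable_scalef.
    apply: filterS x0 => u u0; rewrite !ger0_norm ?ge_min ?lexx//.
    by rewrite le_min u0 mulr_ge0.
  have h1 : {ae nu, forall y, Top (fun u => Num.min (x u) (m%:R * w u)) y <= Top x y}.
    apply: (op_le bX0 bX1 lin pos) => //.
    by apply: aeW => u; rewrite ge_min lexx.
  have h2 : {ae nu, forall y, Top (fun u => Num.min (x u) (m%:R * w u)) y <=
      Top (fun u => m%:R * w u) y}.
    apply: (op_le bX0 bX1 lin pos) => //; first exact/XC_inS/XCZ.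
    by apply: aeW => u; rewrite ge_min lexx orbT.
  apply: filter_app (opZ lin m%:R (XC_inS wX)).
  apply: filterS3 Tx h1 h2 => y <- k1 k2 k3; case: ifPn => //.
  rewrite -leNgt => k4; apply: le_trans k2 _; rewrite k3.
  exact: mulr_ge0_le0.
apply: filterS3 Tx Wp => y -> W_gt0; case: ifPn => // _ h.
by move: W_gt0; rewrite ltNge h.
Qed.

(* The range of [Top] is an order ideal: [y] is the increasing limit of the
   [min y (n Top w)], which belong to the Calderon product where [Top] is onto. *)
Lemma op_ideal (y : S2 -> R) h : measurable_fun setT y -> inS h ->
  {ae nu, forall z, 0 <= y z /\ y z <= Top h z} ->
  exists x, [/\ inS x, {ae mu, forall u, 0 <= x u /\ x u <= h u} &
    {ae nu, forall z, Top x z = y z}].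
Proof.
move=> my sh yh; case: iso => i1 i2 i3 i4 i5.
have [w [wX w0 wp]] := calderon_unit bX0 bX1 s.
have Tw0 := op_unit_gt0 wX w0 wp; have [mTw TwY] := i1 _ wX.
pose yn n z := Num.min (y z) (n%:R * Top w z).
have myn n : measurable_fun setT (yn n).
  by apply: measurable_minf => //; exact: measurable_scalef.
have yn0 n : {ae nu, forall z, 0 <= yn n z}.
  apply: filterS2 yh Tw0 => z [h1 _] h2.
  by rewrite le_min h1 mulr_ge0// ltW.
have ynY n : inX YC (yn n).
  have nTw : inX YC (fun z => n%:R * Top w z).
    have := calderon_lin bY0 bY1 s01 n%:R 0 (i1 _ wX) (i1 _ wX).
    by congr inX; apply/funext => z; ring.
  apply: (calderon_le bY0 bY1 (myn n) _ nTw).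
  apply: filterS2 (yn0 n) Tw0 => z h1 h2; rewrite !ger0_norm//.
    by rewrite ge_min lexx orbT.
  by rewrite mulr_ge0// ltW.
have /choice[xn hxn] : forall n, exists x, inX XC x /\
    {ae nu, forall z, Top x z = yn n z} by move=> n; exact: i3.
have sxn n : inS (xn n) by apply: XC_inS; case: (hxn n).
have Txn n : {ae nu, forall z, Top (xn n) z = yn n z} by case: (hxn n).
have xn0 n : {ae mu, forall u, 0 <= xn n u}.
  by apply: op_ge0_inv => //; apply: filterS2 (Txn n) (yn0 n) => z ->.
have xnh n : {ae mu, forall u, xn n u <= h u}.
  apply: op_le_inv => //; apply: filterS2 (Txn n) yh => z -> [_].
  by apply: le_trans; rewrite ge_min lexx.
(* Bipositivity carries the order of the [yn n] back to their preimages, which therefore have a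
   limit below [h]. *)
have xn_nd : {ae mu, forall u n, xn n u <= xn n.+1 u}.
  apply: ae_foralln => n; apply: op_le_inv => //.
  apply: filterS3 (Txn n) (Txn n.+1) Tw0 => z -> -> h1.
  by rewrite le_min !ge_min lexx/= ler_wpM2r ?orbT ?ler_nat ?ltW.
have xn0' := ae_foralln xn0; have xnh' := ae_foralln xnh.
have [||x [mx xnx xn_cv]] := ae_nondecreasing_lim _ xn_nd.
- by move=> n; case: (sxn n).
- by apply: filterS xnh' => u hu; exists (h u).
have xh : {ae mu, forall u, 0 <= x u /\ x u <= h u}.
  apply: filter_app xnx; apply: filterS3 xn0' xnh' xn_cv => u h1 h2 h3 h4.
  split; first exact: le_trans (h4 0%N).
  by apply: cvgr_to_le h3 _; exact: nearW.
have sx : inS x.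
  apply: (inSum_le bX0 bX1 sh mx); apply: filterS xh => u [h1 h2].
  by rewrite !ger0_norm// (le_trans h1).
exists x; split=> //.
have h1 : {ae nu, forall z, Top x z <= y z}.
  apply: (op_order_continuous bX0 bX1 bY0 bY1 rX0 rX1 lin pos bd0 bd1 sx (h := xn)).
  - by move=> n; case: (sxn n).
  - by apply: filterS3 xn0' xn_nd xnx => u *; split.
  - exact: xn_cv.
  - by move=> n; apply: filterS (Txn n) => z ->; rewrite ge_min lexx.
have h2 : {ae nu, forall z n, yn n z <= Top x z}.
  apply: ae_foralln => n.
  have : {ae nu, forall z, Top (xn n) z <= Top x z}.
    by apply: (op_le bX0 bX1 lin pos) => //; apply: filterS xnx.
  by apply: filterS2 (Txn n) => z ->.
apply: filterS3 Tw0 h1 h2 => z k1 k2 k3; apply/eqP; rewrite eq_le k2/=.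
(* From this index on the truncation no longer cuts: [yn n z = y z]. *)
have := k3 (Num.truncn (y z / Top w z)).+1; rewrite /yn.
rewrite (min_idPl _)// -ler_pdivrMr//; exact/ltW/truncnS_gt.
Qed.

End OrderIsomorphism.

(** * The iterated inequality for real numbers *)

Section IteratedGeometricMean.
Context {R : realType} (s : R) (s01 : 0 < s < 1).

(* Multiplying the inequalities for k < n makes the u_k telescope. *)
Lemma geomean_telescope (D eta : R) (z u : nat -> R) n : 0 <= D ->
  (forall k, geomean s eta (u k) <= D * geomean s (z k) (u k.+1)) ->
  (eta `^ (1 - s)) ^+ n * u 0%N `^ s <=
  D ^+ n * (\prod_(k < n) z k `^ (1 - s)) * u n `^ s.
Proof.
move=> D0 h; elim: n => [|n IH]; first by rewrite !expr0 big_ord0 !mul1r.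
rewrite exprS -mulrA; apply: (@le_trans _ _ (eta `^ (1 - s) *
  (D ^+ n * (\prod_(k < n) z k `^ (1 - s)) * u n `^ s))).
  by apply: ler_wpM2l; rewrite ?powR_ge0.
rewrite big_ord_recr exprS /=.
have P0 : 0 <= \prod_(k < n) z k `^ (1 - s).
  by apply: prodr_ge0 => k _; exact: powR_ge0.
have := ler_wpM2l (mulr_ge0 (exprn_ge0 n D0) P0) (h n).
by rewrite /geomean; congr (_ <= _); ring.
Qed.

Lemma prod_powR_le_mean (z : nat -> R) n : (forall k, 0 <= z k) ->
  \prod_(k < n.+1) z k `^ (1 - s) <=
  ((n.+1%:R^-1 * \sum_(k < n.+1) z k) `^ (1 - s)) ^+ n.+1.
Proof.
move=> z0.
have -> : \prod_(k < n.+1) z k `^ (1 - s) = (\prod_(k < n.+1) z k) `^ (1 - s).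
  elim: n.+1 => [|m IH]; first by rewrite !big_ord0 powR1.
  by rewrite !big_ord_recr/= IH powRM// prodr_ge0.
have S0 : 0 <= \sum_(k < n.+1) z k by apply: sumr_ge0.
have G0 : 0 <= n.+1%:R^-1 * \sum_(k < n.+1) z k by rewrite mulr_ge0.
rewrite -powR_mulrn ?powR_ge0// powRAC powR_mulrn//.
apply: ge0_ler_powR.
- by case/andP: s01; lra.
- by rewrite nnegrE prodr_ge0.
- by rewrite nnegrE exprn_ge0.
have := leif_AGM (A := [pred: 'I_n.+1 | true]) (E := fun k : 'I_n.+1 => z k).
move=> /(_ (fun i _ => z0 i))[+ _]; rewrite cardT size_enum_ord.
by rewrite mulrC.
Qed.

(** The last two hypotheses combine to [u n.+1 <= 4^(n+1) * u 0]. After telescoping, [u 0] cancels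
    and everything is an [(n+1)]-st power; the root leaves [4^s], free of [n], and the exponent
    [1/(1-s)] isolates [eta]. *)
Lemma geomean_iteration (D eta V : R) (z u : nat -> R) n : 0 < D -> 0 <= eta ->
  (forall k, 0 <= z k) -> (forall k, 0 <= u k) -> 0 < u 0%N ->
  (forall k, geomean s eta (u k) <= D * geomean s (z k) (u k.+1)) ->
  u n.+1 <= 2 ^+ n.+2 * V -> 2 * V <= 2 ^+ n.+1 * u 0%N ->
  eta <= (D * 4 `^ s) `^ (1 - s)^-1 * (n.+1%:R^-1 * \sum_(k < n.+1) z k).
Proof.
move=> D0 e0 z0 u0 u0p h uV VA; set G := n.+1%:R^-1 * _.
have [s0 s1] : 0 < s /\ 0 < 1 - s by case/andP: s01; lra.
have G0 : 0 <= G by rewrite mulr_ge0// sumr_ge0.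
have us : u n.+1 `^ s <= (4 `^ s) ^+ n.+1 * u 0%N `^ s.
  rewrite -powR_mulrn ?powR_ge0// powRAC powR_mulrn// -powRM ?exprn_ge0//.
  apply: ge0_ler_powR; rewrite ?nnegrE ?mulr_ge0 ?exprn_ge0// ?(ltW s0)//.
  apply: (le_trans uV); rewrite (_ : 4 = 2 * 2 :> R); last by ring.
  rewrite [2 ^+ n.+2]exprS exprMn [2 * _]mulrC -!mulrA; exact: ler_wpM2l.
have key : (eta `^ (1 - s)) ^+ n.+1 <= (D * 4 `^ s * G `^ (1 - s)) ^+ n.+1.
  have up : 0 < u 0%N `^ s by exact: powR_gt0.
  rewrite -(ler_pM2r up).
  apply: le_trans (geomean_telescope n.+1 (ltW D0) h) _.
  rewrite !exprMn -!mulrA; apply: ler_wpM2l; first by rewrite exprn_ge0// ltW.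
  rewrite [leRHS]mulrCA; apply: ler_pM (prod_powR_le_mean n z0) us.
    by apply: prodr_ge0 => k _; exact: powR_ge0.
  exact: powR_ge0.
have {key} : eta `^ (1 - s) <= D * 4 `^ s * G `^ (1 - s).
  move: key; rewrite ler_pXn2r// nnegrE ?powR_ge0//.
  by rewrite !mulr_ge0 ?powR_ge0// ltW.
have E0 : 0 <= D * 4 `^ s by rewrite mulr_ge0 ?powR_ge0// ltW.
move=> key; have : (eta `^ (1 - s)) `^ (1 - s)^-1 <=
    (D * 4 `^ s * G `^ (1 - s)) `^ (1 - s)^-1.
  apply: ge0_ler_powR => //; rewrite ?nnegrE ?powR_ge0 ?invr_ge0 ?(ltW s1)//.
  by rewrite mulr_ge0 ?powR_ge0.
by rewrite powRM ?powR_ge0// -!powRrM mulfV ?gt_eqF// !powRr1.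
Qed.

End IteratedGeometricMean.

(** * Domination by the range at the endpoint 0 *)

Section Endpoint.
Context {R : realType} d1 d2 (S1 : measurableType d1) (S2 : measurableType d2).
Context (mu : {measure set S1 -> \bar R}) (nu : {measure set S2 -> \bar R}).
Context (X0 X1 : (S1 -> R) -> \bar R) (Y0 Y1 : (S2 -> R) -> \bar R).
Context (Top : (S1 -> R) -> (S2 -> R)).
Context (bX0 : banach_lattice mu X0) (bX1 : banach_lattice mu X1).
Context (bY0 : banach_lattice nu Y0) (bY1 : banach_lattice nu Y1).
Context (rX0 : regular mu X0) (rX1 : regular mu X1).
Context (lin : linear_op mu nu X0 X1 Y0 Y1 Top).
Context (pos : positive_op mu nu X0 X1 Top).
Context (bd0 : bounded_op X0 Y0 Top) (bd1 : bounded_op X1 Y1 Top).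
Context (s : R) (s01 : 0 < s < 1).
Context (iso : order_iso mu nu (calderon mu X0 X1 s) (calderon nu Y0 Y1 s) Top).

Local Notation inS := (inSum mu X0 X1).

Definition pos_ball (N : (S1 -> R) -> \bar R) (f : S1 -> R) :=
  [/\ inX N f, (N f <= 1)%E & forall x, 0 <= f x].

Let normalized (N : (S1 -> R) -> \bar R) f M : banach_lattice mu N ->
  inX N f -> (forall x, 0 <= f x) -> 0 < M -> fine (N f) <= M ->
  pos_ball N (fun x => M^-1 * f x).
Proof.
move=> bl hf f0 M0 fM; split; first exact: (inXZ bl).
  rewrite (lnormZ bl); last by case: hf.
  rewrite -(fineK (inX_fin bl hf)) -EFinM lee_fin ger0_norm ?invr_ge0 ?(ltW M0)//.
  by rewrite mulrC ler_pdivrMr// mul1r.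
by move=> x; rewrite mulr_ge0// invr_ge0 ltW.
Qed.

(* Were no constant [D] suitable, a sequence of counterexamples would be
   dominated by a single element, to which surjectivity of [Top] applies. *)
Lemma uniform_geomean_bound : exists2 D : R, 0 < D &
  forall y0 x1, inX Y0 y0 -> (Y0 y0 <= 1)%E -> pos_ball X1 x1 ->
  exists p, [/\ pos_ball X0 p.1, pos_ball X1 p.2 &
    {ae nu, forall y, geomean s `|y0 y| (Top x1 y) <=
       D * geomean s (Top p.1 y) (Top p.2 y)}].
Proof.
apply: contrapT => H.
(* The constants [4^n] outgrow the factors [2^(n+1)] lost when the counterexamples are dominated. *)
have /choice[q hq] : forall n : nat, exists q : (S2 -> R) * (S1 -> R),
    [/\ inX Y0 q.1, (Y0 q.1 <= 1)%E, pos_ball X1 q.2 &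
    ~ exists p, [/\ pos_ball X0 p.1, pos_ball X1 p.2 &
    {ae nu, forall y, geomean s `|q.1 y| (Top q.2 y) <=
       4 ^+ n * geomean s (Top p.1 y) (Top p.2 y)}]].
  move=> n; apply: contrapT => Hn; apply: H; exists (4 ^+ n).
    exact: exprn_gt0.
  move=> y0 x1 h0 h1 h2; apply: contrapT => Hp.
  by apply: Hn; exists (y0, x1).
have [W [WX W0 Wd]] : exists v, [/\ inX Y0 v, (forall x, 0 <= v x) &
    {ae nu, forall x n, `|(q n).1 x| <= 2 ^+ n.+1 * v x}].
  by apply: (ball_dominated bY0) => n; case: (hq n).
have [V [VX V0 Vd]] : exists v, [/\ inX X1 v, (forall x, 0 <= v x) &
    {ae mu, forall x n, `|(q n).2 x| <= 2 ^+ n.+1 * v x}].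
  by apply: (ball_dominated bX1) => n; case: (hq n) => _ _ [].
have TVY : inX Y1 (Top V) by case: bd1 => C /(_ _ VX)[].
have sV := inSum1 bX0 bX1 VX.
have TV0 := op_ge0 pos sV V0.
(* One application of surjectivity, to [g], handles all counterexamples: the [n]-th left-hand side
   is at most [2^(n+1) * g]. *)
pose g y := geomean s (W y) `|Top V y|.
have gY : inX (calderon nu Y0 Y1 s) g.
  have TVn := inX_norm bY1 TVY.
  split; first by apply: measurable_geomean; [case: WX|case: TVn].
  apply/(calderon_ltyP bY0 bY1); exists W, (fun y => `|Top V y|); split => //.
  by apply: aeW => y; rewrite ger0_norm ?geomean_ge0.
have [x [[mx xX] Tx]] : exists x, inX (calderon mu X0 X1 s) x /\
    {ae nu, forall y, Top x y = g y} by case: iso => _ _ i3 _ _; exact: i3.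
have sx := calderon_inSum bX0 bX1 s01 mx xX.
have [f0 [f1 [h0 h1 p0 p1 hx]]] := (calderon_ltyP bX0 bX1 s x).1 xX.
pose M := 1 + fine (X0 f0) + fine (X1 f1).
have n0 : 0 <= fine (X0 f0) by rewrite fine_ge0// (lnorm_ge0 bX0); case: h0.
have n1 : 0 <= fine (X1 f1) by rewrite fine_ge0// (lnorm_ge0 bX1); case: h1.
have M0 : 0 < M by rewrite /M; lra.
have b0 : pos_ball X0 (fun x => M^-1 * f0 x) by apply: normalized => //; rewrite /M; lra.
have b1 : pos_ball X1 (fun x => M^-1 * f1 x) by apply: normalized => //; rewrite /M; lra.
have s0 := inSum0 bX0 bX1 h0; have s1 := inSum1 bX0 bX1 h1.
have sg : inS (fun x => geomean s (f0 x) (f1 x)).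
  apply: (inSum_geomean_le bX0 bX1 s01 _ h0 h1) => //.
    by apply: measurable_geomean; [case: h0|case: h1].
  by apply: aeW => u; rewrite ger0_norm ?geomean_ge0.
have gT : {ae nu, forall y, g y <= 3 * M * geomean s
    (Top (fun x => M^-1 * f0 x) y) (Top (fun x => M^-1 * f1 x) y)}.
  have k1 : {ae nu, forall y, Top x y <= Top (fun x => geomean s (f0 x) (f1 x)) y}.
    apply: (op_le bX0 bX1 lin pos) => //; apply: filterS hx => u.
    exact/le_trans/ler_norm.
  have k2 := op_geomean bX0 bX1 lin pos s01 h0 h1 p0 p1.
  apply: filter_app (op_ge0 pos s0 p0); apply: filter_app (op_ge0 pos s1 p1).
  apply: filter_app (opZ lin M^-1 s0); apply: filter_app (opZ lin M^-1 s1).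
  apply: filterS3 Tx k1 k2 => y <- k1 k2 -> -> k3 k4.
  rewrite geomeanZ ?invr_ge0 ?(ltW M0)// mulrA mulfK ?gt_eqF//.
  exact: le_trans k1 k2.
(* Then [2^(n+1) * 3 * M <= 4^n], which contradicts the choice of the [n]-th counterexample. *)
have [n hn] : exists n : nat, 6 * M <= 2 ^+ n.
  exists (Num.truncn (6 * M)).+1; apply/ltW/(lt_trans (truncnS_gt _)).
  by rewrite -natrX ltr_nat ltn_expl.
have [_ _ [q1 q2 q3] ] := hq n; apply.
exists (fun x => M^-1 * f0 x, fun x => M^-1 * f1 x); split => //=.
have sq := inSum1 bX0 bX1 q1.
have qV : {ae nu, forall y, Top (q n).2 y <= 2 ^+ n.+1 * Top V y}.
  have : {ae nu, forall y, Top (q n).2 y <= Top (fun x => 2 ^+ n.+1 * V x) y}.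
    apply: (op_le bX0 bX1 lin pos) => //; first exact: inSumZ.
    by apply: filterS Vd => u /(_ n); exact/le_trans/ler_norm.
  by apply: filterS2 (opZ lin (2 ^+ n.+1) sV) => y ->.
apply: filter_app TV0; apply: filter_app (op_ge0 pos sq q3).
apply: filterS3 Wd qV gT => y /(_ n) k1 k2 k3 k4 k5.
apply: (@le_trans _ _ (2 ^+ n.+1 * g y)).
  rewrite /g (ger0_norm k5) -geomeanZ ?exprn_ge0//.
  exact: le_geomean.
apply: (@le_trans _ _ (2 ^+ n.+1 * (3 * M * geomean s
    (Top (fun x => M^-1 * f0 x) y) (Top (fun x => M^-1 * f1 x) y)))).
  by apply: ler_wpM2l => //; exact: exprn_ge0.
rewrite mulrA; apply: ler_wpM2r; first exact: geomean_ge0.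
rewrite (_ : 4 = 2 * 2 :> R); last by ring.
rewrite exprMn exprS -mulrA mulrCA; apply: ler_wpM2l; first exact: exprn_ge0.
by move: hn; lra.
Qed.

(** Start of the iteration, where [Top w] must be positive in order to cancel. The image of the mean
    of two weak units is positive and, by [op_geomean], at most 3 times the mean of their images, so
    the second image cannot vanish. *)
Lemma endpoint_unit : exists2 w, pos_ball X1 w & {ae nu, forall y, 0 < Top w y}.
Proof.
have [w0 [h0 p0]] := ex_weak_unit bX0; have [w1 [h1 p1]] := ex_weak_unit bX1.
have k0 := inX_norm bX0 h0; have k1 := inX_norm bX1 h1.
pose M := 1 + fine (X1 (fun x => `|w1 x|)).
have M1 : 0 <= fine (X1 (fun x => `|w1 x|)).
  by rewrite fine_ge0// (lnorm_ge0 bX1); case: k1.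
have M0 : 0 < M by rewrite /M; lra.
exists (fun x => M^-1 * `|w1 x|); first by apply: normalized => //; rewrite /M; lra.
have wX : inX (calderon mu X0 X1 s) (fun x => geomean s `|w0 x| `|w1 x|).
  split; first by apply: measurable_geomean; [case: k0|case: k1].
  apply/(calderon_ltyP bX0 bX1); exists (fun x => `|w0 x|), (fun x => `|w1 x|).
  by split=> //; apply: aeW => x; rewrite ger0_norm// geomean_ge0.
have Tw : {ae nu, forall y, 0 < Top (fun x => geomean s `|w0 x| `|w1 x|) y}.
  apply: (op_unit_gt0 bX0 bX1 bY0 bY1 rX0 rX1 lin pos bd0 bd1 s01 iso wX).
    by move=> x; exact: geomean_ge0.
  by apply: filterS2 p0 p1 => x x0 x1; rewrite geomean_gt0 ?normr_gt0 ?gt_eqF.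
have s1 := inSum1 bX0 bX1 k1.
have gm := op_geomean bX0 bX1 lin pos s01 k0 k1 (fun=> normr_ge0 _) (fun=> normr_ge0 _).
apply: filter_app (op_ge0 pos s1 (fun=> normr_ge0 _)).
apply: filterS3 Tw gm (opZ lin M^-1 s1) => y t1 t2 -> t3.
rewrite mulr_gt0 ?invr_gt0//; apply: (@geomean_gt0r _ s s01 (Top (fun x => `|w0 x|) y)) => //.
lra.
Qed.

Context (fatou0 : fatou_property mu X0).

Lemma endpoint_ball_dominated : exists2 E : R, 0 < E &
  forall y0, inX Y0 y0 -> (Y0 y0 <= 1)%E ->
  exists f, [/\ inX X0 f, (X0 f <= E%:E)%E &
    {ae nu, forall y, `|y0 y| <= Top f y}].
Proof.
have [D D0 HD] := uniform_geomean_bound.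
have [w wB wp] := endpoint_unit.
pose E := (D * 4 `^ s) `^ (1 - s)^-1.
have E0 : 0 < E by rewrite powR_gt0// mulr_gt0 ?powR_gt0.
exists E => // y0 y0Y y01.
have my0 : measurable_fun setT y0 by case: y0Y.
(* [F] has to be total to be iterated; outside the ball its value is arbitrary, and [x1B] keeps the
   iterates inside. *)
have /choice[F HF] : forall x1, exists p, pos_ball X1 x1 ->
    [/\ pos_ball X0 p.1, pos_ball X1 p.2 &
    {ae nu, forall y, geomean s `|y0 y| (Top x1 y) <=
       D * geomean s (Top p.1 y) (Top p.2 y)}].
  move=> x1; have [/(HD _ _ y0Y y01)[p hp]|nB] := pselect (pos_ball X1 x1).
    by exists p.
  by exists (x1, x1).
pose x1 k := iter k (fun x => (F x).2) w; pose x0 k := (F (x1 k)).1.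
have x1B k : pos_ball X1 (x1 k) by elim: k => // k /HF[].
have x0B k : pos_ball X0 (x0 k) by have [] := HF _ (x1B k).
have Hk k : {ae nu, forall y, geomean s `|y0 y| (Top (x1 k) y) <=
    D * geomean s (Top (x0 k) y) (Top (x1 k.+1) y)}.
  by have [] := HF _ (x1B k).
have x1X k : inX X1 (x1 k) by case: (x1B k).
have x0X k : inX X0 (x0 k) by case: (x0B k).
have sx1 k := inSum1 bX0 bX1 (x1X k); have sx0 k := inSum0 bX0 bX1 (x0X k).
have [v [vX v0 vd]] : exists v, [/\ inX X1 v, (forall x, 0 <= v x) &
    {ae mu, forall x n, `|x1 n x| <= 2 ^+ n.+1 * v x}].
  by apply: (ball_dominated bX1) => // n; case: (x1B n).
have sv := inSum1 bX0 bX1 vX.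
have x1v : {ae nu, forall y n, Top (x1 n) y <= 2 ^+ n.+1 * Top v y}.
  apply: ae_foralln => n.
  have : {ae nu, forall y, Top (x1 n) y <= Top (fun x => 2 ^+ n.+1 * v x) y}.
    apply: (op_le bX0 bX1 lin pos) => //; first exact: inSumZ.
    by apply: filterS vd => u /(_ n); exact/le_trans/ler_norm.
  by apply: filterS2 (opZ lin (2 ^+ n.+1) sv) => y ->.
have x1p : {ae nu, forall y n, 0 <= Top (x1 n) y}.
  by apply: ae_foralln => n; apply: (op_ge0 pos) => //; case: (x1B n).
have x0p : {ae nu, forall y n, 0 <= Top (x0 n) y}.
  by apply: ae_foralln => n; apply: (op_ge0 pos) => //; case: (x0B n).
have {}Hk := ae_foralln Hk.
(* The last hypothesis of [geomean_iteration], with [V = Top v] and [u 0 = Top w]. Since [Top w > 0]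
   a.e., these sets exhaust the space. *)
pose a n y := 2 * Top v y <= 2 ^+ n.+1 * Top w y.
have ma n : measurable_fun setT (a n).
  apply: measurable_fun_ler; apply: measurable_scalef.
    exact: (op_measurable lin sv).
  by apply: (op_measurable lin); exact: (sx1 0%N).
pose h n y := if a n y then `|y0 y| else 0.
have mh n : measurable_fun setT (h n).
  by apply: measurable_if0 => //; exact: measurable_normf.
have h0 n y : 0 <= h n y by rewrite /h; case: ifP.
(* [E] times an average of elements of the unit ball, so its norm is at most [E] for every [n]. *)
pose g n x := (E / n.+1%:R) * \sum_(k < n.+1) x0 k x.
have ssum n := inSum_sum bX0 bX1 n sx0.
have gX n : inX X0 (g n) /\ (X0 (g n) <= E%:E)%E.
  have sumX m : inX X0 (fun x => \sum_(k < m) x0 k x) /\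
      (X0 (fun x => (\sum_(k < m) x0 k x)%R) <= m%:R%:E)%E.
    elim: m => [|m [IH1 IH2]].
      have -> : (fun x => \sum_(k < 0) x0 k x) = (fun=> 0).
        by apply/funext => x; rewrite big_ord0.
      by split; [exact: (inX0 bX0)|rewrite (lnorm0 bX0)].
    have -> : (fun x => \sum_(k < m.+1) x0 k x) =
        (fun x => (\sum_(k < m) x0 k x) + x0 m x).
      by apply/funext => x; rewrite big_ord_recr.
    split; first exact: (inXD bX0).
    apply: le_trans (lnormD bX0 _ _) _; [by case: IH1|by case: (x0X m)|].
    rewrite -natr1 EFinD; apply: leeD => //.
    by case: (x0B m).
  have [k1 k2] := sumX n.+1; split; first exact: (inXZ bX0).
  rewrite (lnormZ bX0); last by case: k1.
  rewrite ger0_norm; last by rewrite divr_ge0// ltW.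
  apply: (@le_trans _ _ ((E / n.+1%:R)%:E * n.+1%:R%:E)%E).
    by apply: lee_wpmul2l => //; rewrite lee_fin divr_ge0// ltW.
  by rewrite -EFinM lee_fin divfK.
have sg n : inS (g n) by apply: (inSum0 bX0 bX1); case: (gX n).
have hg n : {ae nu, forall y, 0 <= h n y /\ h n y <= Top (g n) y}.
  have e1 := op_sum bX0 bX1 lin n.+1 sx0.
  have e2 := opZ lin (E / n.+1%:R) (ssum n.+1).
  apply: filter_app x0p; apply: filter_app x1p; apply: filter_app x1v.
  apply: filter_app wp; apply: filterS3 e1 e2 Hk => y e1 e2 k1 k2 k3 k4 k5.
  split=> //; rewrite /g e2 e1 /h.
  case: ifPn => [ay|_]; last first.
    by rewrite mulr_ge0 ?sumr_ge0// divr_ge0// ltW.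
  rewrite -mulrA.
  exact: (geomean_iteration s01 D0 _ k5 k4 k2 k1 (k3 n.+1) ay).
(* The [h n] increase with [n], so by [op_le_inv] their preimages do too; being below [g n], these
   inherit its norm bound. *)
have /choice[f Hf] n := op_ideal bX0 bX1 bY0 bY1 rX0 rX1 lin pos bd0 bd1 s01 iso
  (mh n) (sg n) (hg n).
have sf n : inS (f n) by case: (Hf n).
have f0 n : {ae mu, forall x, 0 <= f n x /\ f n x <= g n x} by case: (Hf n).
have Tf n : {ae nu, forall y, Top (f n) y = h n y} by case: (Hf n).
have fg n : {ae mu, forall x, `|f n x| <= `|g n x|}.
  by apply: filterS (f0 n) => x [k1 k2]; rewrite !ger0_norm// (le_trans k1).
have fX n : inX X0 (f n).
  by apply: (inX_le bX0 (gX n).1) => //; case: (sf n).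
have fE n : (X0 (f n) <= E%:E)%E.
  apply: le_trans (gX n).2; apply: (lnorm_le bX0) => //; first by case: (sf n).
  by case: (sg n).
have f_nd : {ae mu, forall x n, 0 <= f n x /\ f n x <= f n.+1 x}.
  apply: ae_foralln => n.
  have : {ae mu, forall x, f n x <= f n.+1 x}.
    apply: (op_le_inv bX0 bX1 bY0 bY1 rX0 rX1 lin pos bd0 bd1 s01 iso) => //.
    apply: filterS3 (Tf n) (Tf n.+1) wp => y -> -> wy.
    rewrite /h; case: ifPn => [ay|_]; last exact: h0.
    rewrite ifT//; apply: (le_trans ay); apply: ler_wpM2r; first exact: ltW.
    by rewrite [leRHS]exprS ler_peMl ?exprn_ge0// ler1n.
  by apply: filterS2 (f0 n) => x [].
have [G [GX GE fG]] := fatou_bounded bX0 fatou0 fX f_nd fE.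
exists G; split => //.
have hG : {ae nu, forall y n, h n y <= Top G y}.
  apply: ae_foralln => n.
  have : {ae nu, forall y, Top (f n) y <= Top G y}.
    apply: (op_le bX0 bX1 lin pos) => //; first exact: (inSum0 bX0 bX1).
    by apply: filterS fG.
  by apply: filterS2 (Tf n) => y ->.
apply: filterS2 wp hG => y wy hy.
(* The quotient is below [n + 1 < 2^(n+1)], so [a n y] holds and [h n y = |y0 y|]. *)
pose n := Num.truncn (2 * Top v y / Top w y).
have := hy n; rewrite /h ifT// /a -ler_pdivrMr//; apply/ltW.
apply: (lt_trans (truncnS_gt _)).
by rewrite -/n -natrX ltr_nat ltn_expl.
Qed.

Lemma endpoint_dominated : exists2 E : R, 0 < E & forall y0, inX Y0 y0 ->
  exists f, [/\ inX X0 f, (X0 f <= E%:E * Y0 y0)%E &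
    {ae nu, forall y, `|y0 y| <= Top f y}].
Proof.
have [E E0 HE] := endpoint_ball_dominated; exists E => // y0 hy.
have my : measurable_fun setT y0 by case: hy.
have Y0fin := inX_fin bY0 hy.
have c0 : 0 <= fine (Y0 y0) by rewrite fine_ge0// (lnorm_ge0 bY0).
(* A null element cannot be normalised; it is dominated by 0. *)
have [cE|cn0] := eqVneq (fine (Y0 y0)) 0.
  have y00 : Y0 y0 = 0%E by rewrite -(fineK Y0fin) cE.
  exists (fun=> 0); split; first exact: (inX0 bX0).
    by rewrite (lnorm0 bX0) y00 mule0.
  have := op0 bX0 bX1 lin s01.
  by apply: filterS2 (lnorm_eq0 bY0 my y00) => y -> ->; rewrite normr0.
set c := fine (Y0 y0) in c0 cn0 *.
have c_gt0 : 0 < c by rewrite lt_neqAle eq_sym cn0.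
have [||f [fX fE fy]] := HE (fun y => c^-1 * y0 y).
- exact: (inXZ bY0).
- rewrite (lnormZ bY0)// -(fineK Y0fin) -EFinM lee_fin -/c.
  by rewrite ger0_norm ?invr_ge0// mulVf.
exists (fun x => c * f x); split.
- exact: (inXZ bX0).
- rewrite (lnormZ bX0); last by case: fX.
  rewrite -(fineK Y0fin) -/c muleC (ger0_norm c0).
  by apply: lee_wpmul2r => //; rewrite lee_fin.
- apply: filterS2 fy (opZ lin c (inSum0 bX0 bX1 fX)) => y + ->.
  by rewrite normrM ger0_norm ?invr_ge0// mulrC ler_pdivrMr// mulrC.
Qed.

End Endpoint.

(** * The positive inverse on the whole sum *)

Section Inverse.
Context {R : realType} d1 d2 (S1 : measurableType d1) (S2 : measurableType d2).
Context (mu : {measure set S1 -> \bar R}) (nu : {measure set S2 -> \bar R}).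
Context (X0 X1 : (S1 -> R) -> \bar R) (Y0 Y1 : (S2 -> R) -> \bar R).
Context (Top : (S1 -> R) -> (S2 -> R)).
Context (bX0 : banach_lattice mu X0) (bX1 : banach_lattice mu X1).
Context (bY0 : banach_lattice nu Y0) (bY1 : banach_lattice nu Y1).
Context (rX0 : regular mu X0) (rX1 : regular mu X1).
Context (fX0 : fatou_property mu X0) (fX1 : fatou_property mu X1).
Context (lin : linear_op mu nu X0 X1 Y0 Y1 Top).
Context (pos : positive_op mu nu X0 X1 Top).
Context (bd0 : bounded_op X0 Y0 Top) (bd1 : bounded_op X1 Y1 Top).
Context (s : R) (s01 : 0 < s < 1).
Context (iso : order_iso mu nu (calderon mu X0 X1 s) (calderon nu Y0 Y1 s) Top).

Local Notation inS := (inSum mu X0 X1).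

Let op_le_invS f g : inS f -> inS g -> {ae nu, forall y, Top f y <= Top g y} ->
  {ae mu, forall x, f x <= g x}.
Proof. exact: (op_le_inv bX0 bX1 bY0 bY1 rX0 rX1 lin pos bd0 bd1 s01 iso). Qed.

Let op_eq_invS f g : inS f -> inS g -> {ae nu, forall y, Top f y = Top g y} ->
  {ae mu, forall x, f x = g x}.
Proof. exact: (op_eq_inv bX0 bX1 bY0 bY1 rX0 rX1 lin pos bd0 bd1 s01 iso). Qed.

Lemma endpoint_dominated1 : exists2 E : R, 0 < E & forall y1, inX Y1 y1 ->
  exists f, [/\ inX X1 f, (X1 f <= E%:E * Y1 y1)%E &
    {ae nu, forall y, `|y1 y| <= Top f y}].
Proof.
have lin' : linear_op mu nu X1 X0 Y1 Y0 Top.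
  case: lin => l1 l2 l3; split.
  - by move=> f /inSum_swap/l1/inSum_swap.
  - by move=> f g /inSum_swap hf /inSum_swap hg; exact: l2.
  - by move=> a b f g /inSum_swap hf /inSum_swap hg; exact: l3.
have pos' : positive_op mu nu X1 X0 Top.
  by move=> f /inSum_swap hf; exact: pos.
have s01' : 0 < 1 - s < 1 by case/andP: s01 => ? ?; apply/andP; split; lra.
apply: (endpoint_dominated bX1 bX0 bY1 bY0 rX1 rX0 lin' pos' bd1 bd0 s01' _ fX1).
by rewrite !calderon_swap.
Qed.

(** The dominating elements of the two endpoints add up to one for [|y|]; [op_ideal] then reaches
    the positive and negative parts of [y] separately. *)
Lemma op_surjective y : inSum nu Y0 Y1 y ->
  exists x, inS x /\ {ae nu, forall z, Top x z = y z}.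
Proof.
move=> [my [y0 [y1 [h0 h1 hy]]]].
have [E0 _ /(_ _ h0)[f0 [k0 _ l0]]] := endpoint_dominated bX0 bX1 bY0 bY1 rX0 rX1
  lin pos bd0 bd1 s01 iso fX0.
have [E1 _ /(_ _ h1)[f1 [k1 _ l1]]] := endpoint_dominated1.
have s0 := inSum0 bX0 bX1 k0; have s1 := inSum1 bX0 bX1 k1.
have sf := inSumD bX0 bX1 s0 s1.
have dom : {ae nu, forall z, `|y z| <= Top (fun x => f0 x + f1 x) z}.
  apply: filter_app (opD lin s0 s1); apply: filterS3 hy l0 l1 => z -> k2 k3 ->.
  by apply: (le_trans (ler_normD _ _)); exact: lerD.
have part (q : S2 -> R) : measurable_fun setT q ->
    (forall z, 0 <= q z /\ q z <= `|y z|) ->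
    exists x, inS x /\ {ae nu, forall z, Top x z = q z}.
  move=> mq hq.
  have [|x [sx _ Tx]] := op_ideal bX0 bX1 bY0 bY1 rX0 rX1 lin pos bd0 bd1 s01 iso mq sf.
    by apply: filterS dom => z hz; have [? q2] := hq z; split=> //; exact: le_trans hz.
  by exists x.
have [||xp [sp Tp]] := part (fun z => Num.max (y z) 0).
- exact: measurable_maxf.
- by move=> z; rewrite le_max lexx orbT ge_max ler_norm normr_ge0.
have [||xn [sn Tn]] := part (fun z => Num.max (- y z) 0).
- by apply: measurable_maxf => //; exact: measurable_oppf.
- by move=> z; rewrite le_max lexx orbT ge_max normr_ge0 -normrN ler_norm.
exists (fun x => xp x - xn x); split; first exact: inSumB.
apply: filterS3 Tp Tn (opB lin sp sn) => z h2 h3 ->; rewrite h2 h3 /Num.max.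
by case: ifPn; case: ifPn; rewrite -?leNgt; lra.
Qed.

Lemma op_inverse : exists Sop : (S2 -> R) -> (S1 -> R),
  [/\ linear_op nu mu Y0 Y1 X0 X1 Sop, positive_op nu mu Y0 Y1 Sop,
      bounded_op Y0 X0 Sop, bounded_op Y1 X1 Sop &
      forall y, inSum nu Y0 Y1 y -> {ae nu, forall z, Top (Sop y) z = y z}].
Proof.
have /choice[Sop HS] : forall y, exists x, inSum nu Y0 Y1 y ->
    inS x /\ {ae nu, forall z, Top x z = y z}.
  move=> y; have [/op_surjective[x hx]|ny] := pselect (inSum nu Y0 Y1 y).
    by exists x.
  by exists (fun=> 0).
have sS y : inSum nu Y0 Y1 y -> inS (Sop y) by move=> /HS[].
have TS y : inSum nu Y0 Y1 y -> {ae nu, forall z, Top (Sop y) z = y z}.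
  by move=> /HS[].
(* From [|y| <= Top f], bipositivity gives [|Sop y| <= f], so [Sop y] inherits the norm bound of
   [f]. One argument serves both endpoints. *)
have bounded (Y : (S2 -> R) -> \bar R) (X : (S1 -> R) -> \bar R) (E : R) :
    banach_lattice mu X -> (forall y, inX Y y -> inSum nu Y0 Y1 y) ->
    (forall f, inX X f -> inS f) ->
    (forall y, inX Y y -> exists f, [/\ inX X f, (X f <= E%:E * Y y)%E &
      {ae nu, forall z, `|y z| <= Top f z}]) -> bounded_op Y X Sop.
  move=> bl YS XS dom; exists E => y hy; have sy := YS _ hy.
  have [f [fX fE fy]] := dom _ hy; have sf := XS _ fX.
  have k1 : {ae mu, forall x, Sop y x <= f x}.
    apply: op_le_invS; rewrite ?sS//; first exact: sS.
    by apply: filterS2 (TS _ sy) fy => z ->; exact/le_trans/ler_norm.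
  have k2 : {ae mu, forall x, -1 * Sop y x <= f x}.
    apply: op_le_invS => //; first by apply: inSumZ => //; exact: sS.
    apply: filterS3 (TS _ sy) fy (opZ lin (-1) (sS _ sy)) => z h1 h2 ->.
    by rewrite h1 mulN1r; apply: le_trans h2; rewrite -normrN ler_norm.
  have k3 : {ae mu, forall x, `|Sop y x| <= `|f x|}.
    apply: filterS2 k1 k2 => x h1 h2; apply: le_trans (ler_norm _).
    by rewrite ler_norml; lra.
  have mS : measurable_fun setT (Sop y) by case: (sS _ sy).
  split; first exact: (inX_le bl fX).
  by apply: le_trans fE; apply: (lnorm_le bl) => //; case: fX.
exists Sop; split => //.
- split=> [y /sS//|f g hf hg fg|a b f g hf hg].
    apply: op_eq_invS; try exact: sS.
    by apply: filterS3 (TS _ hf) (TS _ hg) fg => z -> ->.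
  have hl := inSum_lin bY0 bY1 a b hf hg.
  apply: op_eq_invS; [exact: sS|by apply: inSum_lin => //; exact: sS|].
  have l3 : {ae nu, forall z, Top (fun x => a * Sop f x + b * Sop g x) z =
      a * Top (Sop f) z + b * Top (Sop g) z}.
    by case: lin => _ _; apply; exact: sS.
  apply: filter_app l3; apply: filterS3 (TS _ hl) (TS _ hf) (TS _ hg).
  by move=> z -> -> -> ->.
- move=> f hf f0.
  apply: (op_ge0_inv bX0 bX1 bY0 bY1 rX0 rX1 lin pos bd0 bd1 s01 iso (sS _ hf)).
  by apply: filterS2 (TS _ hf) f0 => z ->.
- have [E _ dom] := endpoint_dominated bX0 bX1 bY0 bY1 rX0 rX1
    lin pos bd0 bd1 s01 iso fX0.
  by apply: (bounded _ _ E) => //; [exact: inSum0|exact: inSum0].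
- have [E _ dom] := endpoint_dominated1.
  by apply: (bounded _ _ E) => //; [exact: inSum1|exact: inSum1].
Qed.

(** Injectivity and bipositivity already hold on the whole sum, so for each pair of intermediate
    spaces only membership under [Top] and [Sop] is left to check. *)
Lemma order_iso_of_inverse (Sop : (S2 -> R) -> (S1 -> R))
    (Z : (S1 -> R) -> \bar R) (W : (S2 -> R) -> \bar R) :
  (forall y, inSum nu Y0 Y1 y -> {ae nu, forall z, Top (Sop y) z = y z}) ->
  (forall f, inX Z f -> inS f) -> (forall g, inX W g -> inSum nu Y0 Y1 g) ->
  (forall f, inX Z f -> inX W (Top f)) -> (forall g, inX W g -> inX Z (Sop g)) ->
  order_iso mu nu Z W Top.
Proof.
move=> TS ZS WS ZW WZ; split=> //.
- by move=> f g /ZS sf /ZS sg; exact: op_eq_invS.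
- by move=> g hg; exists (Sop g); split; [exact: WZ|exact/TS/WS].
- by move=> f /ZS sf; exact: pos.
- move=> f /ZS sf.
  exact: (op_ge0_inv bX0 bX1 bY0 bY1 rX0 rX1 lin pos bd0 bd1 s01 iso sf).
Qed.

End Inverse.

Theorem theorem5p2 (R : realType) (d1 d2 : measure_display)
  (S1 : measurableType d1) (S2 : measurableType d2)
  (mu : {measure set S1 -> \bar R}) (nu : {measure set S2 -> \bar R})
  (X0 X1 : (S1 -> R) -> \bar R) (Y0 Y1 : (S2 -> R) -> \bar R)
  (Top : (S1 -> R) -> (S2 -> R)) :
  sigma_finite setT mu -> sigma_finite setT nu ->
  banach_lattice mu X0 -> banach_lattice mu X1 ->
  banach_lattice nu Y0 -> banach_lattice nu Y1 ->
  regular mu X0 -> regular mu X1 -> regular nu Y0 -> regular nu Y1 ->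
  fatou_property mu X0 -> fatou_property mu X1 ->
  fatou_property nu Y0 -> fatou_property nu Y1 ->
  linear_op mu nu X0 X1 Y0 Y1 Top ->
  positive_op mu nu X0 X1 Top ->
  bounded_op X0 Y0 Top -> bounded_op X1 Y1 Top ->
  (exists2 thstar : R, 0 < thstar < 1 &
     order_iso mu nu (calderon mu X0 X1 thstar) (calderon nu Y0 Y1 thstar) Top) ->
  forall theta : R, 0 < theta < 1 ->
    order_iso mu nu (calderon mu X0 X1 theta) (calderon nu Y0 Y1 theta) Top /\
    (forall p : \bar R, (1 <= p)%E ->
       order_iso mu nu (realint mu X0 X1 theta p) (realint nu Y0 Y1 theta p) Top).
Proof.
move=> _ _ bX0 bX1 bY0 bY1 rX0 rX1 _ _ fX0 fX1 _ _ lin pos bd0 bd1 [s s01 iso].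
move=> theta t01.
have [Sop [Slin Spos Sbd0 Sbd1 TS]] := op_inverse bX0 bX1 bY0 bY1 rX0 rX1 fX0 fX1
  lin pos bd0 bd1 s01 iso.
have isoI := order_iso_of_inverse bX0 bX1 bY0 bY1 rX0 rX1 lin pos bd0 bd1 s01 iso TS.
split=> [|p p1]; apply: isoI.
- by move=> f [mf hf]; exact: (calderon_inSum bX0 bX1 t01).
- by move=> g [mg hg]; exact: (calderon_inSum bY0 bY1 t01).
- by move=> f; exact: op_calderon.
(* The inverse satisfies the same hypotheses with the couples exchanged, so the interpolation lemma
   for [Top] applies to it verbatim. *)
- by move=> g; exact: (op_calderon bY0 bY1 Slin Spos).
- by move=> f [mf hf]; exact: (realint_inSum p1 mf hf).
- by move=> g [mg hg]; exact: (realint_inSum p1 mg hg).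
- by move=> f; exact: (op_realint bX0 bX1 bY0 bY1 lin).
- by move=> g; exact: (op_realint bY0 bY1 bX0 bX1 Slin).
Qed.
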